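(* Let $(\bar N,g)$ be an $n$-dimensional Riemannian manifold isometrically embedded in $\mathbb{R}^S$, $N\subset\bar N$ compact, and $1\le m\le n-1$. The following are equivalent: (i) $N$ contains no non-zero $m$-varifold with null generalized second fundamental form; (ii) there exist an increasing function $\Phi:[0,\infty)\to[0,\infty)$ with $\Phi(0)=0$ and a function $F:G_m(N)\times\mathbb{R}^{S^3}\to[0,\infty)$ satisfying condition (F) such that every $m$-varifold $V$ on $N$ with generalized second fundamental form $A$ satisfies $|V|\le\Phi\big(\int_{G_m(N)}F(x,P,A)\,dV\big)$; (iii) for every $F:G_m(N)\times\mathbb{R}^{S^3}\to[0,\infty)$ satisfying condition (F) there is $C_F>0$ such that every $m$-varifold $V$ on $N$ with generalized second fundamental form $A$ satisfies $|V|\le C_F\int_{G_m(N)}F(x,P,A)\,dV$.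
   Context: $G(S,m)$ is the Grassmannian of $m$-planes in $\mathbb{R}^S$, each $P$ identified with its orthogonal projection matrix $(P_{ij})$; $Q(x)=(Q_{ij}(x))$ is the orthogonal projection onto $T_x\bar N$; $G_m(N)=\{(x,P):x\in N,\ P\subset T_x\bar N\}$. An $m$-varifold on $N$ is any Radon measure $V$ on $G_m(N)$ (not necessarily rectifiable); $|V|=V(G_m(N))$. $V$ has generalized curvature $B=(B_{ijk})$, $B_{ijk}\in L^1_{loc}(V)$, if for all $\phi\in C^1_c(\mathbb{R}^S\times\mathbb{R}^{S\times S})$ and each $i$: $0=\int_{G_m(N)}[P_{ij}D_j\phi+B_{ijk}D^*_{jk}\phi+B_{jij}\phi]\,dV$ (summation convention; $D_j$ derivative in $x_j$, $D^*_{jk}$ derivative in $P_{jk}$); its generalized second fundamental form is $A^k_{ij}=P_{lj}B_{ikl}-P_{lj}P_{iq}\partial_{x_q}Q_{kl}(x)$. Condition (F) on $F:G_m(N)\times\mathbb{R}^\alpha\to\mathbb{R}$: (i) continuous; (ii) $F\ge0$, and $F(x,P,q)=0$ iff $q=0$; (iii) convex in $q$; (iv) there is a continuous $\phi:G_m(N)\times[0,\infty)\to[0,\infty)$, nondecreasing in the last variable, with $\phi(x,P,t)\to\infty$ locally uniformly as $t\to\infty$, such that $\phi(x,P,|q|)|q|\le F(x,P,q)$. *)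

(* Defs.v *)
From HB Require Import structures.
From mathcomp Require Import all_boot all_order all_algebra.
From mathcomp Require Import all_classical all_reals all_analysis.
Set Implicit Arguments.
Unset Strict Implicit.
Unset Printing Implicit Defensive.
Import Order.TTheory GRing.Theory Num.Theory numFieldNormedType.Exports.
Local Open Scope classical_set_scope.
Local Open Scope ring_scope.

Section Defs.
Variable R : realType.

Fixpoint Ck (U W : normedModType R) (k : nat) (f : U -> W) : Prop :=
  match k with
  | 0 => continuous f
  | k'.+1 => (forall x, differentiable f x) /\ (forall v : U, Ck k' ('D_v f))
  end.

Definition smooth (U W : normedModType R) (f : U -> W) : Prop :=
  forall k, Ck k f.

Variable S : nat.

Definition RV : normedModType R := 'rV[R]_S.

Definition embedded_submanifold (n : nat) (M : set 'rV[R]_S) : Prop :=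
  (n <= S)%N /\
  forall x, M x -> exists (U : set 'rV[R]_S) (f : 'rV[R]_S -> 'rV[R]_(S - n)),
    [/\ open (U : set RV), U x, smooth f,
        (forall y, U y -> (M y <-> f y = 0)) &
        (forall y, U y -> M y -> forall w : 'rV[R]_(S - n),
            exists v : 'rV[R]_S, 'D_v f y = w)].

Definition tangent (M : set 'rV[R]_S) (x : 'rV[R]_S) : set 'rV[R]_S :=
  [set v | exists g : R -> 'rV[R]_S,
     [/\ g 0 = x, (\forall t \near 0, M (g t)), derivable g 0 1 & 'D_1 g 0 = v]].

Definition orth_proj_onto (Q : 'M[R]_S) (T : set 'rV[R]_S) : Prop :=
  [/\ Q^T = Q, Q *m Q = Q, (forall v, T (v *m Q)) & (forall v, T v -> v *m Q = v)].

(* G(S,m): m-planes identified with their orthogonal projection matrices *)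
Definition grassmann (m : nat) (P : 'M[R]_S) : Prop :=
  [/\ P^T = P, P *m P = P & \rank P = m].

Definition GX : normedModType R := ('rV[R]_S * 'M[R]_S)%type.

Definition Gm (Nbar N : set 'rV[R]_S) (m : nat) : set GX :=
  [set z | [/\ N z.1, grassmann m z.2 & forall v, tangent Nbar z.1 (v *m z.2)]].

Definition GXm := g_sigma_algebraType [set A : set GX | open A].

(* an m-varifold on N: a Radon (= finite Borel, since G_m(N) is compact)
   measure on G_m(N), represented as a finite Borel measure on the ambient
   space R^S x R^(SxS) concentrated on G_m(N). *)
Definition varifold (G : set GX) (V : {measure set GXm -> \bar R}) : Prop :=
  (V setT < +oo)%E /\ V (~` G) = 0%E.

Definition C1c (phi : GX -> R) : Prop :=
  [/\ (forall z, differentiable phi z), (forall v : GX, continuous ('D_v phi))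
    & compact (closure [set z | phi z != 0])].

Definition Dx (j : 'I_S) (phi : GX -> R) : GX -> R :=
  'D_((delta_mx 0 j : 'rV[R]_S, 0 : 'M[R]_S) : GX) phi.
Definition DP (j k : 'I_S) (phi : GX -> R) : GX -> R :=
  'D_((0 : 'rV[R]_S, delta_mx j k : 'M[R]_S) : GX) phi.

(* V has generalized curvature B = (B_ijk), B_ijk in L^1_loc(V)
   (= L^1(V) on the compact set G_m(N)) *)
Definition gen_curvature (G : set GX) (V : {measure set GXm -> \bar R})
  (B : GX -> 'I_S -> 'I_S -> 'I_S -> R) : Prop :=
  (forall i j k, V.-integrable (G : set GXm) (fun z : GXm => (B z i j k)%:E)) /\
  (forall phi, C1c phi -> forall i : 'I_S,
     (\int[V]_(z in (G : set GXm))
        ((\sum_j z.2 i j * Dx j phi z)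
         + (\sum_j \sum_k B z i j k * DP j k phi z)
         + (\sum_j B z j i j * phi z))%:E = 0)%E).

(* generalized second fundamental form
     A^k_ij = P_lj B_ikl - P_lj P_iq d_{x_q} Q_kl(x),
   stored as the S x (S*S) matrix whose k-th row is mxvec (A^k_ij)_{i,j}. *)
Definition sff (Q : 'rV[R]_S -> 'M[R]_S) (B : GX -> 'I_S -> 'I_S -> 'I_S -> R)
  (z : GX) : 'M[R]_(S, S * S) :=
  \matrix_(k < S) mxvec (\matrix_(i < S, j < S)
     ((\sum_l z.2 l j * B z i k l)
      - \sum_l \sum_q z.2 l j * z.2 i q * ('D_(delta_mx 0 q : 'rV[R]_S) Q z.1) k l)).

(* R^(S^3) (the space of the tensors A^k_ij) as a normed module *)
Definition T3 : normedModType R := 'M[R]_(S, S * S).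

Definition condF (G : set GX) (F : GX -> T3 -> R) : Prop :=
  [/\ {within G `*` setT, continuous (fun p : GX * T3 => F p.1 p.2)},
      (forall z q, G z -> 0 <= F z q /\ (F z q = 0 <-> q = 0)),
      (forall z q1 q2 (t : R), G z -> 0 <= t -> t <= 1 ->
          F z (t *: q1 + (1 - t) *: q2) <= t * F z q1 + (1 - t) * F z q2) &
      exists phi : GX -> R -> R,
        [/\ {within G `*` [set t : R | 0 <= t],
               continuous (fun p : GX * R^o => phi p.1 p.2)},
            (forall z t, G z -> 0 <= t -> 0 <= phi z t),
            (forall z s t, G z -> 0 <= s -> s <= t -> phi z s <= phi z t),
            (forall z0, G z0 -> exists U : set GX, nbhs z0 U /\
                forall M : R, exists T : R, forall z t, G z -> U z -> T <= t ->
                  M <= phi z t) &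
            (forall z q, G z -> phi z `|q| * `|q| <= F z q)]].

End Defs.

(* Main.v *)
Require Import Defs.
From HB Require Import structures.
From mathcomp Require Import all_boot all_order all_algebra.
From mathcomp Require Import all_classical all_reals all_analysis.
From mathcomp Require Import measurable_realfun.
From mathcomp Require Import ring lra.
Import Order.TTheory GRing.Theory Num.Theory numFieldNormedType.Exports.
Local Open Scope classical_set_scope.
Local Open Scope ring_scope.
Set Implicit Arguments.
Unset Strict Implicit.
Unset Printing Implicit Defensive.

(* The implications (iii) => (ii) => (i) are immediate, with F = |q|^2 and
   Phi (t) = C_F t for the first one.  For (i) => (iii), varifolds violating every
   constant have, after division by their mass, second fundamental forms tending to
   zero in L^1, because convexity of F and compactness of G_m(N) give
   F (x, P, q) >= d_e (|q| - e).  A weak limit of the normalized measures exists by the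
   Riesz representation theorem, and it remains to see that it is a nonzero varifold
   with null second fundamental form.  The curvature is recovered from A: testing with
   phi (P - P P^T)_ab and with phi (x, P P^T) replaces B_i by B_i P + (B_i P)^T, whose
   entries are those of A plus c = K + K^T with K_i = (D_{P e_i} Q) P.  The tensor c is
   continuous on G_m(N): a local equation f = 0 of the manifold expresses P (D_v Q) by
   the first two derivatives of f, the tangent space being exactly the kernel of Df by
   the implicit function theorem.  So the limit has generalized curvature c, and the
   second fundamental form of c vanishes because P (D_v Q) P = 0. *)

(** * Distance to the complement and bump functions *)

(** Two obstacles shape the argument. The curvature [B] is merely integrable, and an energy bound
    says nothing about it directly: [A] sees [B_i] only after multiplication by [P]. Therefore [B]
    is eliminated from the curvature identity before any limit is taken. What remains is one fixed
    integrand, continuous on G_m(N), plus terms linear in [A] that vanish in the mean; no limit of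
    the [B] themselves is ever formed.

    The second obstacle is that [Q] is only assumed differentiable at the points of the manifold,
    and is not known to be a projection elsewhere, so its derivative carries no continuity by
    itself. Only derivatives along tangent vectors occur, because the rows of [P] are tangent. These
    are computed along curves in the manifold, where the projection identities can be
    differentiated, and their continuity comes from the smooth local equation. *)

Section Bump.
Variables (R : realType) (X : normedModType R).

(** The value 1 keeps the infimum over a nonempty set when the complement of [A] is empty, so the
    whole space needs no separate case. *)
Definition codist (A : set X) (x : X) : R :=
  inf [set r | r = 1 \/ exists2 y, ~ A y & r = `|x - y|].

Let codist_lb (A : set X) x :
  lbound [set r : R | r = 1 \/ exists2 y, ~ A y & r = `|x - y|] 0.
Proof. by move=> r [->|[y _ ->]]. Qed.

Let codist_ne (A : set X) x :
  [set r : R | r = 1 \/ exists2 y, ~ A y & r = `|x - y|] !=set0.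
Proof. by exists 1; left. Qed.

Lemma codist_ge0 A x : 0 <= codist A x.
Proof. exact: lb_le_inf. Qed.

Lemma codist_out (A : set X) x : ~ A x -> codist A x = 0.
Proof.
move=> nAx; apply/eqP; rewrite eq_le codist_ge0 andbT.
apply: ge_inf; first by exists 0.
by right; exists x => //; rewrite subrr normr0.
Qed.

Lemma codist_in (A : set X) x : open A -> A x -> 0 < codist A x.
Proof.
move=> oA Ax; have /nbhs_ballP[e /= e0 he] : nbhs x A by exact: open_nbhs_nbhs.
have : Num.min 1 e <= codist A x.
  apply: lb_le_inf => // r [->|[y nAy ->]]; first by rewrite ge_min lexx.
  rewrite ge_min; apply/orP; right; rewrite leNgt; apply/negP => xy.
  by apply: nAy; apply: he; rewrite -ball_normE.
by apply: lt_le_trans; rewrite lt_min ltr01.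
Qed.

Lemma codist_lip A x z : codist A x <= codist A z + `|x - z|.
Proof.
rewrite -lerBlDr; apply: lb_le_inf => // r [->|[y nAy ->]].
  rewrite lerBlDr (@le_trans _ _ 1) ?lerDl//.
  by apply: ge_inf; [exists 0|left].
rewrite lerBlDr; apply: (@le_trans _ _ `|x - y|); last by rewrite [leRHS]addrC ler_distD.
by apply: ge_inf; [exists 0|right; exists y].
Qed.

Lemma codist_continuous A : continuous (codist A).
Proof.
move=> x; apply/cvgrPdist_lt => e e0; near=> y.
have xy : `|x - y| < e by near: y; exact: (@cvgr_dist_lt _ _ _ (nbhs x) _ id x).
rewrite (le_lt_trans _ xy)// ler_norml; apply/andP; split.
  by rewrite lerBrDr addrC lerBlDr distrC codist_lip.
by rewrite lerBlDr addrC codist_lip.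
Unshelve. all: by end_near. Qed.

Definition bump (A : set X) (m : nat) (x : X) : R :=
  Num.min 1 (m%:R * codist A x).

Lemma bump_continuous A m : continuous (bump A m).
Proof.
move=> x; apply: (@continuous_min R X (fun=> 1)); first exact: cvg_cst.
by apply: cvgM; [exact: cvg_cst|exact: codist_continuous].
Qed.

Lemma bump_ge0 A m x : 0 <= bump A m x.
Proof. by rewrite le_min ler01 mulr_ge0// codist_ge0. Qed.

Lemma bump_le1 A m x : bump A m x <= 1.
Proof. by rewrite ge_min lexx. Qed.

Lemma bump_out (A : set X) m x : ~ A x -> bump A m x = 0.
Proof. by move=> Ax; rewrite /bump codist_out// mulr0 min_r. Qed.

Lemma bump_mono A m n x : (m <= n)%N -> bump A m x <= bump A n x.
Proof.
move=> mn; rewrite le_min ge_min lexx/= ge_min; apply/orP; right.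
by rewrite ler_wpM2r ?codist_ge0// ler_nat.
Qed.

Lemma bump_in (A : set X) x : open A -> A x -> exists m, bump A m x = 1.
Proof.
move=> oA Ax; exists (Num.truncn (codist A x)^-1).+1.
apply: min_l; rewrite -ler_pdivrMr ?codist_in// mul1r ltW//.
exact: truncnS_gt.
Qed.

End Bump.

(** * Borel sets of a normed space *)

Section Borel.
Variables (R : realType) (X : normedModType R).
Local Notation BX := (g_sigma_algebraType [set A : set X | open A]).

Lemma borel_open (A : set X) : open A -> measurable (A : set BX).
Proof. by move=> oA; exact: sub_sigma_algebra. Qed.

Lemma borel_closed (A : set X) : closed A -> measurable (A : set BX).
Proof.
by move=> cA; rewrite -[A]setCK; apply: measurableC; apply: borel_open; exact: closed_openC.
Qed.

Lemma within_continuous_measurable (D : set X) (f : X -> R) :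
  {within D, continuous f} -> measurable_fun (D : set BX) (f : BX -> R).
Proof.
move=> /continuousP cf mD; move: (mD).
apply: (measurability _ (RGenOpens.measurableE R)) => _ [_ [a [b ->] <-]].
have oab : open (`]a, b[%classic : set R) by apply: interval_open => /=. 
have /open_subspaceP[V oV VD] := cf _ oab.
rewrite setIC -VD; apply: measurableI => //; exact: borel_open.
Qed.

Lemma within_continuous_integrable (D : set X) (mu : {measure set BX -> \bar R})
    (f : X -> R) : closed D -> compact D -> (mu D < +oo)%E -> {within D, continuous f} ->
  mu.-integrable (D : set BX) (EFin \o f).
Proof.
move=> clD cD muD cf; apply: measurable_bounded_integrable => //.
- exact: borel_closed.
- exact: within_continuous_measurable.
- have /compact_bounded := continuous_compact cf cD.
  by move=> [M [Mr PM]]; exists M; split => // x /PM h y Dy /=; apply: h; exists y.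
Qed.

End Borel.

(** * Riesz representation on a compact set *)

Section Riesz.
Variables (R : realType) (X : normedModType R) (G : set X).
Variable L : (X -> R) -> R.
Hypothesis compactG : compact G.
Hypothesis LD : forall f g : X -> R, continuous f -> continuous g ->
  L (fun x => f x + g x) = L f + L g.
Hypothesis LZ : forall (a : R) (f : X -> R), continuous f ->
  L (fun x => a * f x) = a * L f.
Hypothesis Lmono : forall f g : X -> R, continuous f -> continuous g ->
  (forall x, G x -> f x <= g x) -> L f <= L g.

Local Notation BX := (g_sigma_algebraType [set A : set X | open A]).

(** Only vanishing off [O] is required, not compact support inside [O]: compactness comes from [G],
    since by [Lmono] the value of [L] depends only on the restriction to [G]. *)
Definition urysohn_below (O : set X) : set (X -> R) :=
  [set f : X -> R | [/\ continuous f, forall x, 0 <= f x, forall x, f x <= 1 &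
     forall x, ~ O x -> f x = 0]].

Definition open_content (O : set X) : \bar R :=
  ereal_sup [set (L f)%:E | f in urysohn_below O].

Definition riesz_outer (A : set X) : \bar R :=
  ereal_inf [set open_content O | O in [set O | open O /\ A `<=` O]].

Let cst_cont (a : R) : continuous (fun _ : X => a).
Proof. by move=> x; exact: cvg_cst. Qed.

Let urysohn_below0 (O : set X) : urysohn_below O (fun=> 0).
Proof. by split => // x; exact: cvg_cst. Qed.

Let L0 : L (fun=> 0) = 0.
Proof.
rewrite -[RHS](mul0r (L (fun=> 0))) -LZ; last exact: cst_cont.
by congr (L _); apply/funext => x; rewrite mul0r.
Qed.

Let Lcst a : L (fun=> a) = a * L (fun=> 1).
Proof.
by rewrite -LZ; [congr (L _); apply/funext => x; rewrite mulr1|exact: cst_cont].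
Qed.

Let Lge0 (f : X -> R) : continuous f -> (forall x, G x -> 0 <= f x) -> 0 <= L f.
Proof. by move=> cf f0; rewrite -L0; apply: Lmono. Qed.

Lemma open_content_ge0 O : (0 <= open_content O)%E.
Proof. by apply: ereal_sup_ubound; exists (fun=> 0) => //; rewrite L0. Qed.

Lemma open_content_le O : (open_content O <= (L (fun=> 1))%:E)%E.
Proof.
apply: ge_ereal_sup => _ [f [cf f0 f1 _] <-]; rewrite lee_fin.
by apply: Lmono.
Qed.

Lemma open_content_mono A B : A `<=` B -> (open_content A <= open_content B)%E.
Proof.
move=> AB; apply: le_ereal_sup => _ [f [cf f0 f1 fA] <-]; exists f => //.
by split => // x Bx; apply: fA => /AB.
Qed.

Lemma le_open_content O f : urysohn_below O f -> ((L f)%:E <= open_content O)%E.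
Proof. by move=> Of; apply: ereal_sup_ubound; exists f. Qed.

Let sum_cont (F : nat -> X -> R) m : (forall n, continuous (F n)) ->
  continuous (fun x => \sum_(n < m) F n x).
Proof.
move=> cF; elim: m => [|m IH].
  under eq_fun do rewrite big_ord0; exact: cst_cont.
under eq_fun do rewrite big_ord_recr /=.
by move=> x; apply: cvgD; [exact: IH|exact: cF].
Qed.

Let L_sum (F : nat -> X -> R) m : (forall n, continuous (F n)) ->
  L (fun x => \sum_(n < m) F n x) = \sum_(n < m) L (F n).
Proof.
move=> cF; elim: m => [|m IH].
  by rewrite big_ord0; under eq_fun do rewrite big_ord0.
rewrite big_ord_recr /= -IH -LD//; last exact: sum_cont.
by under eq_fun do rewrite big_ord_recr /=.
Qed.

(** If [f] lies below the union, the partial sums [S m] of bumps increase and eventually exceed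
    [f - d] at each point of [G]: one bump reaches 1 inside the union, and [f] is 0 outside it.
    Compactness makes one [m] serve all of [G]. *)
Lemma open_content_sigma (O : nat -> set X) : (forall n, open (O n)) ->
  (open_content (\bigcup_n O n) <= \sum_(n <oo) open_content (O n))%E.
Proof.
move=> oO; apply: ge_ereal_sup => _ [f [cf f0 f1 fO] <-].
apply/lee_addgt0Pr => e e0.
(* The constant [d] then costs at most [e] under [L]; the added 1 covers the case [L 1 = 0]. *)
pose d := e / (L (fun=> 1) + 1).
have L10 : 0 <= L (fun=> 1) by apply: Lge0 => // x; exact: cvg_cst.
have d0 : 0 < d by rewrite divr_gt0// ltr_wpDl.
pose S m x := \sum_(n < m) bump (O n) m x.
have cS m : continuous (S m).
  by apply: (@sum_cont (fun n => bump (O n) m)) => n; exact: bump_continuous.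
pose W m := [set x | f x - d < S m x].
have oW m : open (W m).
  rewrite (_ : W m = (fun x => S m x - f x + d) @^-1` [set r | 0 < r]).
    apply: open_comp; last exact: open_gt.
    by move=> x _; apply: cvgD; [apply: cvgB; [exact: cS|exact: cf]|exact: cvg_cst].
  by apply/seteqP; split => x; rewrite /W /= -[f x - d < _]subr_gt0 opprB addrA addrAC.
have GW : G `<=` cover [set: nat] W.
  move=> x Gx.
  have [/fO fx0|[n _ On]] : ~ (\bigcup_n O n) x \/ (\bigcup_n O n) x.
    by case: (pselect ((\bigcup_n O n) x)); [right|left].
    by exists 0%N => //; rewrite /W /= fx0 sub0r /S big_ord0 oppr_lt0.
  have [m bm] := bump_in (oO n) On.
  (* The index must be at least [m] for the bump to equal 1, and above [n] for that bump to occur in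
     the sum. *)
  exists (maxn m n.+1) => //; rewrite /W /= (@lt_le_trans _ _ 1)//.
    by rewrite ltrBlDr (le_lt_trans (f1 x))// ltrDl.
  have nm : (n < maxn m n.+1)%N by rewrite leq_maxr.
  rewrite /S (bigD1 (Ordinal nm))//= ler_wpDr//.
    by apply: sumr_ge0 => i _; exact: bump_ge0.
  by rewrite -bm bump_mono// leq_maxl.
have := compactG; rewrite compact_cover => /(_ _ _ _ (fun n _ => oW n) GW)[D _ GD].
have [m GWm] : exists m, G `<=` W m.
  exists (\max_(i <- finmap.enum_fset D) i)%N => x /GD[i /= iD].
  rewrite /W /= => /lt_le_trans; apply.
  have im : (i <= \max_(i <- finmap.enum_fset D) i)%N by exact: leq_bigmax_seq.
  rewrite /S (@big_ord_widen _ _ _ i (\max_(i <- finmap.enum_fset D) i)%N (fun n => bump (O n) i x))//.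
  rewrite big_mkcond/=; apply: ler_sum => n _.
  by case: ifP => _; [exact: bump_mono|exact: bump_ge0].
have Lf : L f <= \sum_(n < m) L (bump (O n) m) + e.
  have : L f <= L (fun x => S m x + d).
    apply: Lmono => // [x|x /GWm]; first by apply: cvgD; [exact: cS|exact: cvg_cst].
    by rewrite /W/= ltrBlDr => /ltW.
  rewrite LD// (@L_sum (fun n => bump (O n) m)); last by move=> n; exact: bump_continuous.
  move=> /le_trans; apply; rewrite lerD2l Lcst /d mulrAC.
  by rewrite ler_pdivrMr ?ltr_wpDl// ler_pM2l// lerDl.
apply: (@le_trans _ _ (\sum_(n < m) (L (bump (O n) m))%:E + e%:E)%E).
  by rewrite sumEFin -EFinD lee_fin.
rewrite leeD2r//.
apply: (@le_trans _ _ (\sum_(0 <= n < m) open_content (O n))%E).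
  rewrite big_mkord; apply: lee_sum => n _; apply: le_open_content; split.
  - exact: bump_continuous.
  - by move=> x; exact: bump_ge0.
  - by move=> x; exact: bump_le1.
  - by move=> x; exact: bump_out.
by apply: nneseries_lim_ge => n *; exact: open_content_ge0.
Qed.

Lemma riesz_outer_ge0 A : (0 <= riesz_outer A)%E.
Proof. by apply: le_ereal_inf_tmp => _ [U _ <-]; exact: open_content_ge0. Qed.

Lemma riesz_outer_open O : open O -> riesz_outer O = open_content O.
Proof.
move=> oO; apply/eqP; rewrite eq_le; apply/andP; split.
  by apply: ereal_inf_lbound; exists O; split.
by apply: le_ereal_inf_tmp => _ [U [_ OU] <-]; exact: open_content_mono.
Qed.

Lemma riesz_outer0 : riesz_outer set0 = 0%E.
Proof.
rewrite riesz_outer_open; last exact: open0.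
apply/eqP; rewrite eq_le open_content_ge0 andbT.
apply: ge_ereal_sup => _ [f [_ _ _ f0] <-]; rewrite lee_fin.
by rewrite (_ : f = fun=> 0) ?L0//; apply/funext => x; exact: f0.
Qed.

Lemma riesz_outer_mono : {homo riesz_outer : A B / A `<=` B >-> (A <= B)%E}.
Proof.
move=> A B AB; apply: ereal_inf_le_tmp => _ [U [oU BU] <-]; exists U => //.
by split => //; exact: subset_trans BU.
Qed.

Lemma riesz_outer_fin A : riesz_outer A \is a fin_num.
Proof.
rewrite ge0_fin_numE ?riesz_outer_ge0//.
apply: (@le_lt_trans _ _ (L (fun=> 1))%:E); last by rewrite ltry.
apply: le_trans (riesz_outer_mono (@subsetT _ A)) _.
by rewrite riesz_outer_open; [exact: open_content_le|exact: openT].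
Qed.

Lemma riesz_outer_near A e : 0 < e ->
  exists O, [/\ open O, A `<=` O & (open_content O <= riesz_outer A + e%:E)%E].
Proof.
move=> e0; have [_ [U [oU AU] <-] /ltW le] :=
  lb_ereal_inf_adherent e0 (riesz_outer_fin A).
by exists U.
Qed.

Lemma riesz_outer_sigma : sigma_subadditive riesz_outer.
Proof.
move=> F; apply/lee_addgt0Pr => e e0.
apply: le_trans (epsilon_trick _ (fun n => riesz_outer_ge0 (F n)) (ltW e0)).
have en n : 0 < e / (2 ^ n.+1)%:R by rewrite divr_gt0// ltr0n expn_gt0.
have [V PV] := choice (fun n => @riesz_outer_near (F n) _ (en n)).
apply: (@le_trans _ _ (open_content (\bigcup_n V n))).
  apply: ereal_inf_lbound; exists (\bigcup_n V n) => //; split.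
    by apply: bigcup_open => n _; have [] := PV n.
  by apply: subset_bigcup => n _; have [] := PV n.
apply: (le_trans (open_content_sigma _)); first by move=> n; have [] := PV n.
by apply: lee_nneseries => n; [move=> *; exact: open_content_ge0|have [] := PV n].
Qed.

HB.instance Definition _ := isOuterMeasure.Build R X riesz_outer
  riesz_outer0 riesz_outer_ge0 riesz_outer_mono riesz_outer_sigma.

(** For [f] below the intersection, the open set [W] where [f < d] inside [U] contains [U] minus
    [O]. The truncation [g] of [f - d] at 0 and any [h] below [W] are never both nonzero, so [g + h]
    is still below [U], while replacing [f] by [g] loses at most [e]. *)
Lemma open_content_split (U O : set X) : open U -> open O ->
  (open_content (U `&` O) + riesz_outer (U `&` ~` O) <= open_content U)%E.
Proof.
move=> oU oO; rewrite -leeBrDr ?riesz_outer_fin//.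
apply: ge_ereal_sup => _ [f [cf f0 f1 fO] <-].
rewrite leeBrDr ?riesz_outer_fin//; apply/lee_addgt0Pr => e e0.
pose d := e / (L (fun=> 1) + 1).
have L10 : 0 <= L (fun=> 1) by apply: Lge0 => // x; exact: cvg_cst.
have d0 : 0 < d by rewrite divr_gt0// ltr_wpDl.
pose g x := Num.max 0 (f x - d).
have cg : continuous g.
  move=> x; apply: (@continuous_max R X (fun=> 0)); first exact: cvg_cst.
  by apply: cvgB; [exact: cf|exact: cvg_cst].
pose W := U `&` [set x | f x < d].
have oW : open W.
  by apply: openI => //; apply: (open_comp _ (open_lt (y := d))) => x _; exact: cf.
have Lfg : L f <= L g + e.
  have : L f <= L (fun x => g x + d).
    apply: Lmono => // [x|x _]; first by apply: cvgD; [exact: cg|exact: cvg_cst].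
    by rewrite -lerBlDr le_max lexx orbT.
  rewrite LD// => /le_trans; apply; rewrite lerD2l Lcst /d mulrAC.
  by rewrite ler_pdivrMr ?ltr_wpDl// ler_pM2l// lerDl.
apply: (@le_trans _ _ ((L g)%:E + open_content W + e%:E)%E); last first.
  rewrite leeD2r// addeC -leeBrDr//; apply: ge_ereal_sup => _ [h [ch h0 h1 hW] <-].
  rewrite leeBrDr// -EFinD -LD//; apply: le_open_content.
  have gh x : g x = 0 \/ h x = 0.
    have [fd|fd] := ltP (f x) d; [left|right].
      by apply/max_idPl; rewrite subr_le0 ltW.
    by apply: hW => -[_] /=; rewrite ltNge fd.
  have g1 x : g x <= 1 by rewrite ge_max ler01/= lerBlDr (le_trans (f1 x))// lerDl ltW.
  split.
  - by move=> x; apply: cvgD; [exact: ch|exact: cg].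
  - by move=> x; rewrite addr_ge0// le_max lexx.
  - by move=> x; case: (gh x) => ->; rewrite ?addr0 ?add0r.
  - move=> x nUx; rewrite hW ?add0r; last by case.
    by rewrite /g fO ?sub0r; [apply/max_idPl; rewrite oppr_le0 ltW|case].
rewrite addeAC; apply: leeD; first by rewrite -EFinD lee_fin.
apply: ereal_inf_lbound; exists W => //; split => // x [Ux nOx]; split => //=.
by rewrite fO//; case.
Qed.

Lemma open_caratheodory O : open O -> riesz_outer.-caratheodory O.
Proof.
move=> oO; apply: le_caratheodory_measurable => A.
apply: le_ereal_inf_tmp => _ [U [oU AU] <-].
apply: le_trans (open_content_split oU oO); rewrite -(riesz_outer_open (openI oU oO)).
by apply: leeD; apply: le_outer_measure; exact: setSI.
Qed.

Lemma borel_caratheodory (A : set BX) : measurable A -> riesz_outer.-caratheodory A.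
Proof.
move: A; apply: smallest_sub => [|O oO]; last exact: open_caratheodory.
split=> [|B mB|F mF]; first exact: caratheodory_measurable_set0.
  by rewrite setTD; exact: caratheodory_measurable_setC.
exact: caratheodory_measurable_bigcup.
Qed.

Definition riesz_measure (A : set BX) : \bar R := riesz_outer A.

Let riesz_measure0 : riesz_measure set0 = 0%E.
Proof. exact: riesz_outer0. Qed.

Let riesz_measure_ge0 A : (0 <= riesz_measure A)%E.
Proof. exact: riesz_outer_ge0. Qed.

Let riesz_measure_sigma : semi_sigma_additive riesz_measure.
Proof.
move=> F mF tF mUF.
apply: (@caratheodory_measure_sigma_additive R X riesz_outer) => // [n|];
  exact: borel_caratheodory.
Qed.

HB.instance Definition _ := isMeasure.Build _ BX R riesz_measure
  riesz_measure0 riesz_measure_ge0 riesz_measure_sigma.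

Definition riesz : {measure set BX -> \bar R} := riesz_measure.

End Riesz.

(** * Integration against the Riesz measure *)

Section RieszIntegral.
Variables (R : realType) (X : normedModType R) (G : set X).
Variable L : (X -> R) -> R.
Hypothesis closedG : closed G.
Hypothesis compactG : compact G.
Hypothesis LD : forall f g : X -> R, continuous f -> continuous g ->
  L (fun x => f x + g x) = L f + L g.
Hypothesis LZ : forall (a : R) (f : X -> R), continuous f ->
  L (fun x => a * f x) = a * L f.
Hypothesis Lmono : forall f g : X -> R, continuous f -> continuous g ->
  (forall x, G x -> f x <= g x) -> L f <= L g.

Local Notation BX := (g_sigma_algebraType [set A : set X | open A]).


Let V := riesz compactG LD LZ Lmono.

Let Vopen (O : set X) : open O -> V O = open_content L O.
Proof. exact: riesz_outer_open. Qed.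

Let cst_cont (a : R) : continuous (fun _ : X => a).
Proof. by move=> x; exact: cvg_cst. Qed.

Let Lcst a : L (fun=> a) = a * L (fun=> 1).
Proof.
by rewrite -LZ; [congr (L _); apply/funext => x; rewrite mulr1|exact: cst_cont].
Qed.

Let Leq (f g : X -> R) : continuous f -> continuous g ->
  (forall x, G x -> f x = g x) -> L f = L g.
Proof.
by move=> cf cg fg; apply/eqP; rewrite eq_le !Lmono// => x /fg ->.
Qed.

Lemma riesz_setT : V setT = (L (fun=> 1))%:E.
Proof.
rewrite Vopen; last exact: openT.
apply/eqP; rewrite eq_le (open_content_le Lmono)/=.
by apply: le_open_content; split => // x; case/(_ I).
Qed.

Lemma riesz_setC : V (~` G) = 0%E.
Proof.
rewrite Vopen; last exact: closed_openC.
apply/eqP; rewrite eq_le (open_content_ge0 LZ) andbT.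
apply: ge_ereal_sup => _ [f [cf f0 f1 fG] <-]; rewrite lee_fin.
have <- : L (fun=> 0) = 0 by rewrite Lcst mul0r.
by apply: Lmono => // x Gx; rewrite fG//; exact.
Qed.

Let Vfin (A : set BX) : measurable A -> (V A < +oo)%E.
Proof.
move=> mA; apply: (@le_lt_trans _ _ (V setT)).
  by apply: le_measure => //; rewrite inE.
by rewrite riesz_setT ltry.
Qed.

Let Vint (f : X -> R) M : continuous f -> (forall x, `|f x| <= M) ->
  V.-integrable setT (EFin \o f).
Proof.
move=> cf fM; apply: measurable_bounded_integrable => //; first exact: Vfin.
  by apply: within_continuous_measurable; exact: continuous_subspaceT.
exists M; split; first exact: num_real.
by move=> K MK x _ /=; rewrite (le_trans (fM x))// ltW.
Qed.

(* [level f j] is the slice of [f] between heights [j] and [j.+1]; the slices of [N f]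
   are compared with the measures of the sets [N f > j]. *)
Let level (f : X -> R) (j : nat) (x : X) := Num.min (f x) j.+1%:R - Num.min (f x) j%:R.

Let level_cont f j : continuous f -> continuous (level f j).
Proof.
move=> cf x; apply: cvgB; apply: (@continuous_min R X f) => //;
  solve [exact: cf|exact: cvg_cst].
Qed.

Let level_ge0 f j x : 0 <= level f j x.
Proof.
rewrite subr_ge0 le_min !ge_min lexx/=; apply/orP; right.
by rewrite ler_nat.
Qed.

Let level_le1 f j x : level f j x <= 1.
Proof.
rewrite lerBlDr; have [h|h] := leP (f x) j%:R.
  by rewrite ge_min lerDr ler01.
by rewrite ge_min -natr1 addrC lexx orbT.
Qed.

Let level_eq0 f j x : f x <= j%:R -> level f j x = 0.
Proof.
move=> h; rewrite /level !min_l ?subrr//.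
by rewrite (le_trans h)// ler_nat.
Qed.

Let level_eq1 f j x : j.+1%:R <= f x -> level f j x = 1.
Proof.
move=> h; rewrite /level !min_r//; first by rewrite -natr1 addrAC subrr add0r.
by rewrite (le_trans _ h)// ler_nat.
Qed.

Let level_sum f N x : 0 <= f x -> \sum_(j < N) level f j x = Num.min (f x) N%:R.
Proof.
move=> f0; rewrite -(big_mkord xpredT (fun j => level f j x)).
by rewrite telescope_sumr// (min_r f0) subr0.
Qed.

Let level_bound f j x : `|level f j x| <= 1.
Proof. by rewrite ger0_norm. Qed.

(** The slice [j.+1] is supported where [f > j.+1], and on that set the slice [j] equals 1. The
    measure of the set separates the two sides, at the price of shifting the index by one. *)
Let Rint_level f j : continuous f ->
  L (level f j.+1) <= \int[V]_x level f j x.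
Proof.
move=> cf; pose A : set X := [set x | j.+1%:R < f x].
have oA : open A by apply: (open_comp _ (open_gt (y := j.+1%:R))) => x _; exact: cf.
have mA : measurable (A : set BX) by exact: borel_open.
have LA : ((L (level f j.+1))%:E <= V A)%E.
  rewrite Vopen//; apply: le_open_content; split => //; first exact: level_cont.
  by move=> x /negP; rewrite -leNgt => /level_eq0.
have intl : V.-integrable setT (EFin \o level f j).
  by apply: (@Vint _ 1) => //; exact: level_cont.
rewrite -lee_fin (le_trans LA)// fineK; last exact: integrable_fin_num.
rewrite -[A]setIT -integral_indic//; apply: ge0_le_integral => //.
- by apply/measurable_EFinP; exact: measurable_indic.
- by case/integrableP: intl.
- move=> x _; rewrite lee_fin indicE; case: (boolP (x \in A)) => [|_].
    by rewrite inE => /ltW /level_eq1 ->.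
  exact: level_ge0.
Qed.

Let Riesz_le_unit (f : X -> R) : continuous f -> (forall x, 0 <= f x <= 1) ->
  L f <= \int[V]_x f x.
Proof.
move=> cf f01; apply/ler_addgt0Pr => e e0.
(* The index shift leaves the bottom slice unpaired, worth at most [L 1]; divided by the factor
   [N.+1] it is less than [e]. *)
pose N := (Num.truncn (L (fun=> 1) / e)).+1.
pose F x := N.+1%:R * f x.
have cF : continuous F by move=> x; apply: cvgM; [exact: cst_cont|exact: cf].
have F0 x : 0 <= F x by rewrite mulr_ge0//; case/andP: (f01 x).
have FN x : F x <= N.+1%:R by rewrite ler_piMr//; case/andP: (f01 x).
have intF : V.-integrable setT (EFin \o F).
  by apply: (@Vint _ N.+1%:R) => // x; rewrite ger0_norm.
have intf : V.-integrable setT (EFin \o f).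
  by apply: (@Vint _ 1) => // x; rewrite ger0_norm; case/andP: (f01 x).
have cS m : continuous (fun x => \sum_(j < m) level F j x).
  elim: m => [|m IHm]; first by under eq_fun do rewrite big_ord0; exact: cst_cont.
  by under eq_fun do rewrite big_ord_recr/=; move=> x; apply: cvgD;
    [exact: IHm|exact: level_cont].
have Lsum k : L (fun x => \sum_(j < k.+1) level F j x) <=
    L (fun=> 1) + \int[V]_x (\sum_(j < k) level F j x).
  elim: k => [|k IH].
    under eq_fun do rewrite big_ord_recr big_ord0 /= add0r.
    under [X in _ + X]eq_Rintegral do rewrite big_ord0.
    rewrite Rintegral_cst// mul0r addr0.
    by apply: Lmono => //; exact: level_cont.
  under eq_fun do rewrite big_ord_recr/=.
  rewrite LD; [|exact: cS|exact: level_cont].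
  under [X in _ <= _ + X]eq_Rintegral do rewrite big_ord_recr/=.
  rewrite RintegralD//; last 2 first.
  - apply: (@Vint _ k%:R) => [|x]; first exact: cS.
    by rewrite level_sum// ger0_norm ?ge_min ?lexx ?orbT// le_min F0/=.
  - by apply: (@Vint _ 1) => //; exact: level_cont.
  by rewrite addrA lerD// Rint_level.
have LF : N.+1%:R * L f <= L (fun=> 1) + N.+1%:R * \int[V]_x f x.
  rewrite -LZ// -RintegralZl//.
  have <- : L (fun x => \sum_(j < N.+1) level F j x) = L F.
    by apply: Leq => [||x _]; [exact: cS|exact: cF|rewrite level_sum// min_l].
  apply: le_trans (Lsum N) _; rewrite lerD2l; apply: le_Rintegral => //.
    apply: (@Vint _ N%:R) => [|x]; first exact: cS.
    by rewrite level_sum// ger0_norm ?ge_min ?lexx ?orbT// le_min F0/=.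
  by move=> x _; rewrite level_sum// ge_min lexx.
have N0 : 0 < N.+1%:R :> R by rewrite ltr0n.
rewrite -(ler_pM2l N0) (le_trans LF)// mulrDr addrC lerD2l.
have : L (fun=> 1) / e < N.+1%:R.
  by rewrite (lt_le_trans (truncnS_gt _))// ler_nat.
by rewrite ltr_pdivrMr// => /ltW.
Qed.

(** The function [(f + M) / (2 M)] takes values in [0, 1], and the added constant cancels because
    the total mass of [V] is [L 1]. *)
Let Riesz_le (f : X -> R) M : 0 < M -> continuous f -> (forall x, `|f x| <= M) ->
  L f <= \int[V]_x f x.
Proof.
move=> M0 cf fM; pose a := (2 * M)^-1.
have a0 : 0 < a by rewrite invr_gt0 mulr_gt0.
have cM : continuous (fun x => f x + M).
  by move=> x; apply: cvgD; [exact: cf|exact: cvg_cst].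
have caf : continuous (fun x => a * (f x + M)).
  by move=> x; apply: cvgM; [exact: cvg_cst|exact: cM].
have bM x : `|f x + M| <= M + M.
  by rewrite (le_trans (ler_normD _ _))// lerD// ger0_norm// ltW.
have := Riesz_le_unit caf; rewrite LZ// LD// Lcst RintegralZl//; last exact: Vint bM.
rewrite RintegralD//; last 2 first.
- exact: Vint fM.
- by apply: (@Vint _ M) => // x; rewrite ger0_norm// ltW.
rewrite Rintegral_cst// riesz_setT/= ler_pM2l// lerD2r; apply => x.
have := fM x; rewrite ler_norml => /andP[f1 f2]; apply/andP; split.
  by rewrite mulr_ge0// ?(ltW a0)// -lerBlDr sub0r.
by rewrite mulrC ler_pdivrMr ?mulr_gt0// mul1r mulr_natl mulr2n lerD2r.
Qed.

Lemma riesz_Rintegral (f : X -> R) : continuous f ->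
  \int[V]_(x in G) f x = L f.
Proof.
move=> cf; have [M [M0 fM]] : exists M, 0 < M /\ forall x, G x -> `|f x| <= M.
  have /compact_bounded[M [Mr PM]] :=
    continuous_compact (continuous_subspaceT (A := G) cf) compactG.
  exists (`|M| + 1); split; first by rewrite ltr_wpDl.
  move=> x Gx; apply: (PM (`|M| + 1)); last by exists x.
  by rewrite (le_lt_trans (ler_norm _))// ltrDl.
(* Off [G] the function may be unbounded. Truncating at its bound on [G] changes neither side, since
   [L] sees only [G]. *)
pose h x := Num.max (- M) (Num.min M (f x)).
have ch : continuous h.
  move=> x; apply: (@continuous_max R X (fun=> - M)); first exact: cvg_cst.
  by apply: (@continuous_min R X (fun=> M)); [exact: cvg_cst|exact: cf].
have hM x : `|h x| <= M.
  by rewrite ler_norml le_max lexx ge_max ge_min lexx andbT /= (le_trans _ (ltW M0))// oppr_le0 ltW.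
have hf x : G x -> h x = f x.
  move=> /fM; rewrite ler_norml => /andP[f1 f2].
  by rewrite /h min_r// max_r.
have mG : measurable (G : set BX) by exact: borel_closed.
have -> : L f = L h by apply: Leq => // x /hf.
transitivity (\int[V]_x h x).
  rewrite -(setUv G) Rintegral_setU//; last 3 first.
  - exact: measurableC.
  - by rewrite setUv; exact: Vint hM.
  - by apply/disj_setPCl.
  have -> : \int[V]_(x in ~` G) h x = 0.
    rewrite /Rintegral null_set_integral//; first exact: measurableC.
    + apply: measurable_funS (measurable_int _ (Vint ch hM)) => //.
    + exact: riesz_setC.
  by rewrite addr0; apply: eq_Rintegral => x; rewrite inE => /hf.
apply/eqP; rewrite eq_le (Riesz_le M0)// andbT.
(* The one-sided bound applied to [- h] is the reverse inequality. *)
have := @Riesz_le (fun x => (-1) * h x) M M0.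
rewrite LZ// RintegralZl//; last exact: Vint hM.
rewrite !mulN1r lerN2; apply => x; last by rewrite mulN1r normrN.
by apply: cvgM; [exact: cvg_cst|exact: ch].
Qed.

End RieszIntegral.

(** * Weak compactness of measures *)

Lemma ultra_bounded_cvg (R : realType) (U : set_system nat) (a : nat -> R) (M : R) :
  UltraFilter U -> (forall k, `|a k| <= M) -> cvg (a @ U).
Proof.
move=> UU aM.
have FM : (a @ U) `[- M, M]%classic.
  by apply: (@filterE _ U) => k /=; rewrite in_itv/= -ler_norml; exact: aM.
have [l [_ cl]] := @segment_compact R (- M) M (a @ U) _ FM.
apply/cvg_ex; exists l => B lB.
have [//|UB] := @in_ultra_setVsetC _ U (a @^-1` B) UU.
have : (a @ U) (~` B) by exact: UB.
by move=> /cl /(_ lB) [x [nBx Bx]].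
Qed.

Section WeakCompactness.
Variables (R : realType) (X : normedModType R) (G : set X).
Local Notation BX := (g_sigma_algebraType [set A : set X | open A]).
Hypothesis closedG : closed G.
Hypothesis compactG : compact G.

Lemma within_bounded (f : X -> R) : {within G, continuous f} ->
  exists M, 0 < M /\ forall x, G x -> `|f x| <= M.
Proof.
move=> cf; have /compact_bounded[M [Mr PM]] := continuous_compact cf compactG.
exists (`|M| + 1); split; first by rewrite ltr_wpDl.
move=> x Gx; apply: (PM (`|M| + 1)); last by exists x.
by rewrite (le_lt_trans (ler_norm _))// ltrDl.
Qed.

(** The functional [L] acts on functions continuous on the whole space, whereas the limit curvature
    is only known to be continuous on [G]; Tietze extension bridges the two. *)
Lemma within_extension (f : X -> R) : {within G, continuous f} ->
  exists2 g : X -> R, continuous g & forall x, G x -> f x = g x.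
Proof.
move=> cf; have [M [M0 fM]] := within_bounded cf.
have [g [fg cg _]] := @continuous_bounded_extension X R (@pseudometric_normal R X)
  G closedG f M M0 cf fM.
by exists g => // x Gx; apply: fg; rewrite inE.
Qed.

Lemma measures_weakly_compact (mu : nat -> {measure set BX -> \bar R}) :
  (forall k, 0 < mu k (G : set BX) < +oo)%E ->
  exists V : {measure set BX -> \bar R},
    [/\ V setT = 1%E, V (~` G) = 0%E &
      forall (f : X -> R) (l : R), {within G, continuous f} ->
        (fun k => (\int[mu k]_(x in G) f x) / fine (mu k G)) @ \oo --> l ->
        \int[V]_(x in G) f x = l].
Proof.
move=> muG.
have mG : measurable (G : set BX) by exact: borel_closed.
have [U [UU oU]] := ultraFilterLemma eventually_filter.
pose a (f : X -> R) k := (\int[mu k]_(x in G) f x) / fine (mu k G).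
have m0 k : 0 < fine (mu k G) by rewrite fine_gt0.
have int k (f : X -> R) : {within G, continuous f} -> (mu k).-integrable (G : set BX) (EFin \o f).
  by apply: within_continuous_integrable => //; case/andP: (muG k).
have awcvg (f : X -> R) : {within G, continuous f} -> cvg (a f @ U).
  move=> cf; have [M [M0 fM]] := within_bounded cf.
  apply: (@ultra_bounded_cvg _ _ _ M) => k.
  rewrite /a normrM [X in _ * X]gtr0_norm ?invr_gt0// ler_pdivrMr//.
  rewrite (le_trans (le_normr_Rintegral mG (int k f cf)))// -Rintegral_cst//.
  apply: le_Rintegral => //.
    by apply: (int k (fun x => `|f x|)) => x; apply: cvg_norm; exact: cf.
  by apply: (int k (fun=> M)) => x; exact: cvg_cst.
have wcont (f : X -> R) : continuous f -> {within G, continuous f}.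
  exact: continuous_subspaceT.
have acvg (f : X -> R) (cf : continuous f) := awcvg f (wcont f cf).
(* A limit along an ultrafilter replaces the extraction of a subsequence. *)
pose L f := lim (a f @ U).
have Rhaus := @norm_hausdorff R R^o.
have LD (f g : X -> R) : continuous f -> continuous g -> L (fun x => f x + g x) = L f + L g.
  move=> cf cg; apply: cvg_lim => //.
  rewrite (_ : a _ = fun k => a f k + a g k).
    by apply: cvgD; exact: acvg.
  by apply/funext => k; rewrite /a RintegralD//; [rewrite mulrDl|apply: int; exact: wcont..].
have LZ (c : R) (f : X -> R) : continuous f -> L (fun x => c * f x) = c * L f.
  move=> cf; apply: cvg_lim => //.
  rewrite (_ : a _ = fun k => c * a f k).
    by apply: cvgM; [exact: cvg_cst|exact: acvg].
  by apply/funext => k; rewrite /a RintegralZl//; [rewrite mulrA|apply: int; exact: wcont].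
have Lm (f g : X -> R) : continuous f -> continuous g -> (forall x, G x -> f x <= g x) -> L f <= L g.
  move=> cf cg fg; apply: ler_lim; [exact: acvg..|].
  near=> k; rewrite /a ler_pM2r ?invr_gt0//.
  by apply: le_Rintegral => //; apply: int; exact: wcont.
exists (riesz compactG LD LZ Lm); split.
- rewrite riesz_setT; congr (_%:E); apply: cvg_lim => //.
  rewrite (_ : a _ = fun=> 1); first exact: cvg_cst.
  by apply/funext => k; rewrite /a Rintegral_cst// mul1r divff// gt_eqF.
- exact: riesz_setC.
- move=> f l cf al; have [g cg fg] := within_extension cf.
  rewrite (@eq_Rintegral _ _ _ _ _ (g : BX -> R) f); last by move=> x; rewrite inE => /fg.
  rewrite riesz_Rintegral//; apply: cvg_lim => //.
  (* The ultrafilter refines [\oo], so averages converging along [\oo] have the same limit along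
     it. *)
  rewrite (_ : a g = a f); first exact: (cvg_trans (cvg_app _ oU) al).
  by apply/funext => k; congr (_ / _); apply: eq_Rintegral => x; rewrite inE => /fg.
Unshelve. all: by end_near. Qed.

End WeakCompactness.

(** * Strict differentiability of C^1 maps *)

HB.instance Definition _ (R : realType) m n := Complete.on 'M[R]_(m, n).

(** Contraction contributes at most [r / 2] to [|f u|] and the displacement of the centre another
    [r / 2], so the closed ball is invariant. *)
Lemma banach_fixed_point_ball (R : realType) (X : completeNormedModType R)
    (r : R) (f : X -> X) : 0 <= r ->
  (forall u v, `|u| <= r -> `|v| <= r -> `|f u - f v| <= 2^-1 * `|u - v|) ->
  `|f 0| <= 2^-1 * r ->
  exists2 u, `|u| <= r & f u = u.
Proof.
move=> r0 fc f0.
pose U := [set u : X | `|u| <= r].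
have fU : set_fun U U f.
  move=> u /= Uu; rewrite /U /= -[f u](subrK (f 0)) [leRHS](splitr r).
  apply: le_trans (ler_normD _ _) _; rewrite lerD//; last by rewrite mulrC.
  apply: le_trans (fc _ _ Uu _) _; first by rewrite normr0.
  by rewrite subr0 mulrC ler_pM2r.
pose F := mkfun_fun fU.
have [|||u Uu uE] := @banach_fixed_point R X U F.
- exists (NngNum (ltac:(by rewrite invr_ge0) : 0 <= 2^-1 :> R)); split => /=.
    by rewrite invf_lt1 ?ltr1n.
  by move=> [u v] [/= Uu Uv]; exact: fc.
- apply: (@closed_comp _ _ (fun u : X => `|u|) [set x | x <= r]); last exact: closed_le.
  by move=> x _; exact: norm_continuous.
- by exists 0; rewrite /U /= normr0.
- by exists u => //; rewrite [RHS]uE.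
Qed.

Lemma norm_mulmx_le (R : realType) m n p (A : 'M[R]_(m, n)) (B : 'M[R]_(n, p)) :
  `|A *m B| <= n%:R * `|A| * `|B|.
Proof.
rewrite [leLHS]/Num.Def.normr/= mx_normrE; apply: bigmax_le => [|[i j] _].
  by rewrite !mulr_ge0.
rewrite mxE (le_trans (ler_norm_sum _ _ _))//.
have -> : n%:R * `|A| * `|B| = \sum_(k < n) (`|A| * `|B|).
  by rewrite sumr_const card_ord -mulrA mulr_natl.
apply: ler_sum => k _; rewrite normrM ler_pM//.
  by rewrite [leRHS]/Num.Def.normr/= mx_normrE; exact: (le_bigmax _ _ (i, k)).
by rewrite [leRHS]/Num.Def.normr/= mx_normrE; exact: (le_bigmax _ _ (k, j)).
Qed.

Lemma mx_norm_le (R : realType) m n (A : 'M[R]_(m, n)) e : 0 <= e ->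
  (forall i j, `|A i j| <= e) -> `|A| <= e.
Proof.
by move=> e0 Ae; rewrite [leLHS]/Num.Def.normr/= mx_normrE; apply: bigmax_le.
Qed.

Lemma mx_coord_le (R : realType) m n (A : 'M[R]_(m, n)) i j : `|A i j| <= `|A|.
Proof. by rewrite [leRHS]/Num.Def.normr/= mx_normrE; exact: (le_bigmax _ _ (i, j)). Qed.

Lemma mxBE (R : pzRingType) m n (A B : 'M[R]_(m, n)) i j : (A - B) i j = A i j - B i j.
Proof. by rewrite !mxE. Qed.

Lemma mx_cvgP (R : realType) (T : Type) (F : set_system T) (FF : Filter F) m n
    (A : T -> 'M[R]_(m, n)) (B : 'M[R]_(m, n)) :
  (forall i j, (fun t => A t i j) @ F --> B i j) -> A @ F --> B.
Proof.
move=> AB; apply/cvgrPdist_le => e e0; near=> t.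
apply: mx_norm_le; first exact: ltW.
suff : forall i j, `|B i j - A t i j| <= e by move=> h i j; rewrite !mxE.
near: t; apply: filter_forall => i; apply: filter_forall => j.
exact: (cvgrPdist_le _ _).1 (AB i j) _ e0.
Unshelve. all: by end_near. Qed.

Lemma is_derive_line (R : realType) (V : normedModType R) (F : V -> R) (a v : V) (s : R) :
  derivable F (a + s *: v) v ->
  is_derive s (1 : R) (fun s : R => F (a + s *: v)) ('D_v F (a + s *: v)).
Proof.
move=> dF.
have E : (fun h : R => h^-1 *: (F (a + (h *: (1 : R) + s) *: v) - F (a + s *: v))) =
    (fun h : R => h^-1 *: (F (h *: v + (a + s *: v)) - F (a + s *: v))).
  apply/funext => h; congr (_ *: (F _ - _)).
  by rewrite scalerDl [h *: 1]mulr1 addrCA.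
by apply: DeriveDef; rewrite ?/derivable /derive /= E.
Qed.

Lemma derive_coord (R : realType) (V : normedModType R) m n (M : V -> 'M[R]_(m, n)) t v i j :
  derivable M t v -> 'D_v (fun t => M t i j) t = ('D_v M t) i j.
Proof. by move=> dM; rewrite derive_mx// mxE. Qed.

Lemma jacobian_continuous (R : realType) m n (f : 'rV[R]_m -> 'rV[R]_n) :
  (forall x, differentiable f x) -> (forall v, continuous ('D_v f)) ->
  continuous (jacobian f).
Proof.
move=> df cf x; apply: (@mx_cvgP _ _ (nbhs x)) => i j.
rewrite (_ : (fun t => _) = (fun t => 'D_(delta_mx 0 i) f t 0 j)); last first.
  by apply/funext => t; rewrite deriveE// mxE.
rewrite mxE -deriveE//.
apply: (@continuous_comp _ _ _ ('D_(delta_mx 0 i) f) (fun M : 'rV_n => M 0 j)).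
  exact: cf.
exact: coord_continuous.
Qed.

(** The mean value theorem is applied to each coordinate along the segment from [a] to [b]. The
    intermediate point depends on the coordinate, but always stays in the ball where the jacobian is
    close to its value at [y]. *)
Lemma C1_strict_derivative (R : realType) m n (f : 'rV[R]_m -> 'rV[R]_n) y (e : R) :
  (forall x, differentiable f x) -> (forall v, continuous ('D_v f)) -> 0 < e ->
  exists2 d : R, 0 < d & forall a b, `|a - y| < d -> `|b - y| < d ->
    `|f b - f a - (b - a) *m jacobian f y| <= e * `|b - a|.
Proof.
move=> df cf e0.
(* The factor [m] is the one in [norm_mulmx_le]; adding 1 keeps the denominator positive when
   [m = 0]. *)
pose e1 := e / (m%:R + 1).
have m0 : 0 < m%:R + 1 :> R by rewrite ltr_wpDl.
have e10 : 0 < e1 by rewrite divr_gt0.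
have /cvgrPdist_lt/(_ _ e10) := jacobian_continuous df cf (x := y).
move=> /nbhs_ballP[d /= d0 dJ]; exists d => // a b ad bd.
apply: mx_norm_le => [|i j]; first by rewrite mulr_ge0// ltW.
rewrite (ord1 i) {i}.
pose phi (s : R) := f (a + s *: (b - a)) 0 j.
have dphi s : is_derive s (1 : R) phi (('D_(b - a) f (a + s *: (b - a))) 0 j).
  have dd := @diff_derivable _ _ _ f (a + s *: (b - a)) (b - a) (df _).
  rewrite -derive_coord//; apply: (@is_derive_line _ _ (fun x => f x 0 j)).
  by move/derivable_mxP : dd.
have [|s] := MVT ltr01 (fun s _ => dphi s).
  by apply: derivable_within_continuous => s _; have [] := dphi s.
rewrite in_itv/= => /andP[s0 s1]; rewrite subr0 mulr1 => phi10.
have -> : (f b - f a - (b - a) *m jacobian f y) 0 j =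
    phi 1 - phi 0 - ((b - a) *m jacobian f y) 0 j.
  by rewrite /phi scale1r scale0r addr0 subrKC !mxE.
rewrite phi10; set x := a + s *: (b - a); rewrite deriveEjacobian//.
have -> : ((b - a) *m jacobian f x) 0 j - ((b - a) *m jacobian f y) 0 j =
    ((b - a) *m (jacobian f x - jacobian f y)) 0 j.
  by rewrite (mulmxBr (b - a) (jacobian f x)) (mxBE (_ *m _)).
apply: le_trans (mx_coord_le _ _ _) _; apply: le_trans (norm_mulmx_le _ _) _.
have xy : ball y d x.
  rewrite -ball_normE /= distrC.
  have -> : x - y = (1 - s) *: (a - y) + s *: (b - y).
    by apply/rowP => k; rewrite !mxE; ring.
  rewrite (le_lt_trans (ler_normD _ _))// !normrZ !gtr0_norm ?subr_gt0//.
  have -> : d = (1 - s) * d + s * d by ring.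
  by rewrite ltrD// ltr_pM2l// subr_gt0.
have Jle : `|jacobian f x - jacobian f y| <= e1 by rewrite distrC; exact/ltW/dJ.
rewrite mulrAC ler_wpM2r//.
apply: le_trans (ler_wpM2l _ Jle) _ => //.
by rewrite /e1 mulrA ler_pdivrMr// mulrC ler_wpM2l// ?ltW// ltrDl.
Qed.

(** * Curves in level sets *)

(* Newton's iteration transverse to the level set: fixed points of
   [u - f (y + t w + u H)] yield points of the level set above [y + t w], and the
   map is a contraction because [H] inverts the jacobian at [y]. *)
Lemma level_set_solve (R : realType) m n (f : 'rV[R]_m -> 'rV[R]_n) y w (H : 'M[R]_(n, m)) :
  (forall x, differentiable f x) -> (forall v, continuous ('D_v f)) ->
  f y = 0 -> H *m jacobian f y = 1%:M -> w *m jacobian f y = 0 ->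
  exists2 d : R, 0 < d & forall t : R, `|t| < d ->
    exists u : 'rV[R]_n, f (y + t *: w + u *m H) = 0 /\ `|u| <= 2 * `|f (y + t *: w)|.
Proof.
move=> df cf fy HJ wJ.
pose C := n%:R * `|H| + 1.
have C0 : 0 < C by rewrite ltr_wpDl// mulr_ge0.
pose W := `|w| + 1.
have W0 : 0 < W by rewrite ltr_wpDl.
have uH (u : 'rV[R]_n) : `|u *m H| <= C * `|u|.
  rewrite (le_trans (norm_mulmx_le _ _))// /C mulrDl mul1r mulrAC.
  by rewrite ler_wpDr.
(* Since [C] bounds multiplication by [H], this error turns [psi] below into a contraction of ratio
   1/2. *)
have e0 : 0 < 2^-1 / C by rewrite divr_gt0.
have [d d0 dP] := C1_strict_derivative y df cf e0.
move: (jacobian f y) HJ wJ dP => J HJ wJ dP.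
(* Half of the radius [d] is reserved for [t w], the other half for the correction [u H]. *)
exists (d / 2 / W); first by rewrite !divr_gt0.
move=> t; rewrite ltr_pdivlMr// => td.
have twW : `|t *: w| <= `|t| * W by rewrite normrZ ler_wpM2l// lerDl.
pose r := 2 * `|f (y + t *: w)|.
have r0 : 0 <= r by rewrite mulr_ge0.
have ytd : `|y + t *: w - y| < d.
  rewrite [y + _ - y]addrC addKr (le_lt_trans twW)// (lt_trans td)//.
  by rewrite gtr_pMr// invf_lt1 ?ltr1n.
(* As [w] is in the kernel of the jacobian and [f y = 0], strict differentiability bounds
   [f (y + t w)] by [|t| W / (2 C)]. *)
have Cr : C * r <= `|t| * W.
  have := dP y _ _ ytd; rewrite subrr normr0 => /(_ d0).
  rewrite [y + _ - y]addrC addKr -scalemxAl wJ scaler0 fy !subr0 => h.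
  have := ler_wpM2l (ltW (mulr_gt0 (ltr0n R 2) C0)) (le_trans h (ler_wpM2l (ltW e0) twW)).
  have C0' : C != 0 by rewrite gt_eqF.
  have -> : 2 * C * (2^-1 / C * (`|t| * W)) = `|t| * W by field.
  by rewrite /r mulrA [C * 2]mulrC.
pose p (u : 'rV[R]_n) : 'rV[R]_m := y + t *: w + u *m H.
have pd u : `|u| <= r -> `|p u - y| < d.
  move=> ur; rewrite /p addrC !addrA addNr add0r (le_lt_trans (ler_normD _ _))//.
  rewrite [ltRHS]splitr (le_lt_trans (lerD twW (uH u)))// ltrD//.
  by rewrite (le_lt_trans _ td)// (le_trans _ Cr)// ler_wpM2l// ltW.
pose psi (u : 'rV[R]_n) : 'rV[R]_n := u - f (p u).
have psiB u v : `|u| <= r -> `|v| <= r -> `|psi u - psi v| <= 2^-1 * `|u - v|.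
  move=> ur vr; have := dP _ _ (pd _ vr) (pd _ ur).
  have -> : p u - p v = (u - v) *m H by rewrite /p opprD addrACA subrr add0r mulmxBl.
  rewrite -mulmxA HJ mulmx1 => h.
  have -> : psi u - psi v = - (f (p u) - f (p v) - (u - v)).
    by rewrite /psi; apply/rowP => k; rewrite !mxE; ring.
  rewrite normrN (le_trans h)// (le_trans (ler_wpM2l (ltW e0) (uH _)))// mulrA.
  by rewrite -[2^-1 / C * C]mulrA mulVf ?mulr1// gt_eqF.
have psi0 : `|psi 0| <= 2^-1 * r.
  by rewrite /psi /p mul0mx addr0 sub0r normrN /r mulrA mulVf ?mul1r.
have [u ur up] := banach_fixed_point_ball r0 psiB psi0.
exists u; split => //; move/eqP: up.
by rewrite -subr_eq0 addrAC subrr sub0r oppr_eq0 => /eqP.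
Qed.

(** The corrections [u t] are merely chosen, with no regularity in [t]. They are bounded by
    [2 |f (y + t w)|], which is o(t) because the derivative of [f] along [w] is 0; this suffices for
    differentiability at 0, all that [tangent] asks. *)
Lemma level_set_curve (R : realType) m n (f : 'rV[R]_m -> 'rV[R]_n) y w (H : 'M[R]_(n, m)) :
  (forall x, differentiable f x) -> (forall v, continuous ('D_v f)) ->
  f y = 0 -> H *m jacobian f y = 1%:M -> w *m jacobian f y = 0 ->
  exists g : R -> 'rV[R]_m, [/\ g 0 = y, \forall t \near 0, f (g t) = 0,
    derivable g 0 1 & 'D_1 g 0 = w].
Proof.
move=> df cf fy HJ wJ; have [d d0 dP] := level_set_solve df cf fy HJ wJ.
have /choice[u uP] : forall t : R, exists u : 'rV[R]_n, `|t| < d ->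
    f (y + t *: w + u *m H) = 0 /\ `|u| <= 2 * `|f (y + t *: w)|.
  move=> t; have [td|td] := ltP `|t| d; last by exists 0.
  by have [u uP] := dP t td; exists u.
pose g (t : R) : 'rV[R]_m := y + t *: w + u t *m H.
have g0 : g 0 = y.
  have [|_] := uP 0; first by rewrite normr0.
  rewrite scale0r addr0 fy normr0 mulr0 normr_le0 => /eqP u0.
  by rewrite /g u0 mul0mx scale0r !addr0.
have nd : \forall t \near (0 : R), `|t| < d.
  by apply/nbhs_ballP; exists d => //= t; rewrite -ball_normE/= sub0r normrN.
have Dg : (fun h : R => h^-1 *: (g (h *: (1 : R) + 0) - g 0)) @ 0^' --> w.
  have := diff_derivable (v := w) (df y).
  move=> /derivableP/@ex_derive.
  have Dw : 'D_w f y = 0 by rewrite deriveEjacobian.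
  rewrite /derivable => cvD.
  have : (fun h : R => h^-1 *: (f (h *: w + y) - f y)) @ 0^' --> (0 : 'rV[R]_n).
    by rewrite -Dw; exact: cvD.
  move=> fD.
  pose K := 2 * (n%:R * `|H| + 1).
  have K0 : 0 < K by rewrite mulr_gt0// ltr_wpDl// mulr_ge0.
  apply/cvgrPdist_le => e e0.
  have /cvgrPdist_le/(_ (e / K)) := fD; rewrite divr_gt0// => /(_ isT) fDe.
  near=> h.
  have hd : `|h| < d by near: h; apply: nbhs_dnbhs; exact: nd.
  have h0 : h != 0 by near: h; exact: nbhs_dnbhs_neq.
  have [_ uh] := uP h hd.
  have -> : w - h^-1 *: (g (h *: 1 + 0) - g 0) = - ((h^-1 *: u h) *m H).
    rewrite g0 /g addr0 [h *: 1]mulr1 -scalemxAl.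
    by apply/rowP => k; rewrite !mxE; field.
  rewrite normrN (le_trans (norm_mulmx_le _ _))// normrZ.
  have : `|0 - h^-1 *: (f (h *: w + y) - f y)| <= e / K by near: h.
  rewrite sub0r normrN fy subr0 normrZ ler_pdivlMr// => fh.
  apply: le_trans fh; rewrite [h *: w + y]addrC.
  rewrite [leLHS](_ : _ = `|h^-1| * (n%:R * `|H| * `|u h|)); last by ring.
  rewrite -[leRHS]mulrA ler_wpM2l// /K.
  apply: (@le_trans _ _ (n%:R * `|H| * (2 * `|f (y + h *: w)|))).
    by rewrite ler_wpM2l// mulr_ge0.
  rewrite [leLHS](_ : _ = `|f (y + h *: w)| * (2 * (n%:R * `|H|))); last by ring.
  by rewrite ler_wpM2l// ler_wpM2l// lerDl.
exists g; split => //.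
- near=> t; have [|//] := uP t; near: t; exact: nd.
- by apply: cvgP Dg.
- exact: cvg_lim Dg.
Unshelve. all: by end_near. Qed.

(** * Limits and derivatives of matrices *)

Section MatrixLimits.
Variables (R : realType) (T : Type) (F : set_system T).
Hypothesis FF : Filter F.

Lemma cvg_mx_coord m n (A : T -> 'M[R]_(m, n)) (B : 'M[R]_(m, n)) i j :
  A @ F --> B -> (fun t => A t i j) @ F --> B i j.
Proof.
move=> AB; apply: (@continuous_cvg _ _ _ F FF A (fun M : 'M[R]_(m, n) => M i j)) AB.
exact: coord_continuous.
Qed.

Lemma cvg_fsum (I : Type) (r : seq I) (P : pred I) (f : I -> T -> R) (l : I -> R) :
  (forall i, P i -> f i @ F --> l i) ->
  (fun t => \sum_(i <- r | P i) f i t) @ F --> \sum_(i <- r | P i) l i.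
Proof. by move=> fl; apply: cvg_big => //; exact: add_continuous. Qed.

Lemma cvg_fprod (I : Type) (r : seq I) (P : pred I) (f : I -> T -> R) (l : I -> R) :
  (forall i, P i -> f i @ F --> l i) ->
  (fun t => \prod_(i <- r | P i) f i t) @ F --> \prod_(i <- r | P i) l i.
Proof. by move=> fl; apply: cvg_big => //; exact: mul_continuous. Qed.

Lemma cvg_mulmx m n p (A : T -> 'M[R]_(m, n)) (B : T -> 'M[R]_(n, p))
    (A0 : 'M[R]_(m, n)) (B0 : 'M[R]_(n, p)) :
  A @ F --> A0 -> B @ F --> B0 -> (fun t => A t *m B t) @ F --> A0 *m B0.
Proof.
move=> AA BB; apply: mx_cvgP => i j; rewrite mxE.
under eq_fun do rewrite mxE.
by apply: cvg_fsum => k _; apply: cvgM; exact: cvg_mx_coord.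
Qed.

Lemma cvg_det n (A : T -> 'M[R]_n) (A0 : 'M[R]_n) : A @ F --> A0 -> (fun t => \det (A t)) @ F --> \det A0.
Proof.
move=> AA; apply: cvg_fsum => s _; apply: cvgM; first exact: cvg_cst.
by apply: cvg_fprod => i _; exact: cvg_mx_coord.
Qed.

(** Cramer's rule holds as soon as the determinant is nonzero, and it expresses the inverse through
    determinants, which are polynomial in the entries. *)
Lemma cvg_invmx n (A : T -> 'M[R]_n) (A0 : 'M[R]_n) : A0 \in unitmx -> A @ F --> A0 ->
  (fun t => invmx (A t)) @ F --> invmx A0.
Proof.
move=> uA AA; have dA := cvg_det AA.
have dA0 : \det A0 != 0 by move: uA; rewrite unitmxE unitfE.
have nA : \forall t \near F, \det (A t) != 0.
  by move/cvgr_neq0: dA; apply.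
apply: (@cvg_trans _ ((fun t => (\det (A t))^-1 *: \adj (A t)) @ F)).
  apply: near_eq_cvg; near=> t.
  by rewrite /invmx unitmxE unitfE ifT//; near: t.
rewrite /invmx uA; apply: mx_cvgP => i j; rewrite !mxE.
under eq_fun do rewrite !mxE.
apply: cvgM; first exact: cvgV.
apply: cvgM; first exact: cvg_cst.
apply: cvg_det; apply: mx_cvgP => k l; rewrite !mxE.
under eq_fun do rewrite !mxE.
exact: cvg_mx_coord.
Unshelve. all: by end_near. Qed.

End MatrixLimits.

(** * Derivatives along curves *)

Section CurveCalculus.
Variable R : realType.

Lemma derivable_curve_continuous (W : normedModType R) (g : R -> W) t :
  derivable g t 1 -> {for t, continuous g}.
Proof. by move=> /derivable1_diffP/differentiable_continuous. Qed.

Lemma is_derive_along (V W : normedModType R) (F : V -> W) (g : R -> V) t :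
  derivable g t 1 -> differentiable F (g t) ->
  is_derive t (1 : R) (F \o g) ('D_('D_1 g t) F (g t)).
Proof.
move=> /derivable1_diffP dg dF.
have dFg : differentiable (F \o g) t by exact: differentiable_comp.
apply: DeriveDef; first exact: diff_derivable.
by rewrite (deriveE _ dFg) (deriveE _ dF) (deriveE _ dg) diff_comp.
Qed.

Lemma is_derive_mx m n (A : R -> 'M[R]_(m, n)) t (A' : 'M[R]_(m, n)) :
  (forall i j, is_derive t (1 : R) (fun t => A t i j) (A' i j)) -> is_derive t (1 : R) A A'.
Proof.
move=> AA; have dA : derivable A t 1 by apply/derivable_mxP => i j; exact: ex_derive.
apply: DeriveDef => //; rewrite derive_mx//; apply/matrixP => i j; rewrite mxE.
exact: derive_val.
Qed.

Lemma is_derive_mx_coord m n (A : R -> 'M[R]_(m, n)) t (A' : 'M[R]_(m, n)) i j :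
  is_derive t (1 : R) A A' -> is_derive t (1 : R) (fun t => A t i j) (A' i j).
Proof.
move=> [dA <-]; apply: DeriveDef; last exact: derive_coord.
by move/derivable_mxP : dA.
Qed.

Lemma is_derive_mulmx m n p (A : R -> 'M[R]_(m, n)) (B : R -> 'M[R]_(n, p)) t
    (A' : 'M[R]_(m, n)) (B' : 'M[R]_(n, p)) :
  is_derive t (1 : R) A A' -> is_derive t (1 : R) B B' ->
  is_derive t (1 : R) (fun t => A t *m B t) (A' *m B t + A t *m B').
Proof.
move=> AA BB; apply: is_derive_mx => i j.
rewrite (_ : (fun t => _) = \sum_(k < n) ((fun t => A t i k) * (fun t => B t k j))); last first.
  by apply/funext => s; rewrite fct_sumE mxE.
rewrite !mxE -big_split/=.
apply: is_derive_sum => k.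
have := is_deriveM (is_derive_mx_coord i k AA) (is_derive_mx_coord k j BB).
by move/is_derive_eq; apply; rewrite addrC; congr (_ + _); rewrite mulrC.
Qed.

(** This is the device for differentiating an identity valid only on the manifold: it holds along a
    curve in the manifold at all small times. *)
Lemma is_derive_near_unique (W : normedModType R) (F G : R -> W) t F' G' :
  is_derive t (1 : R) F F' -> is_derive t (1 : R) G G' ->
  (\forall s \near t, F s = G s) -> F' = G'.
Proof.
move=> dF dG FG; have := near_eq_is_derive FG dF.
by move=> /@derive_val <-; rewrite (@derive_val _ _ _ _ _ _ _ dG).
Qed.

End CurveCalculus.

(** * Tangent spaces and the derivative of the projection *)

Section LocalGeometry.
Variables (R : realType) (S n : nat) (M : set 'rV[R]_S).

Lemma smooth_C1 (U W : normedModType R) (f : U -> W) : smooth f ->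
  (forall x, differentiable f x) /\ (forall v, continuous ('D_v f)).
Proof. by move=> /(_ 1%N). Qed.

Lemma smooth_C2 (U W : normedModType R) (f : U -> W) : smooth f ->
  (forall v x, differentiable ('D_v f) x) /\
  (forall u v, continuous ('D_u ('D_v f))).
Proof.
by move=> /(_ 2%N)[_ h]; split => [v x|u v]; [have [] := h v|have [_] := h v; apply].
Qed.

Lemma jacobian_left_inverse p (f : 'rV[R]_S -> 'rV[R]_p) y : differentiable f y ->
  (forall w : 'rV[R]_p, exists v : 'rV[R]_S, 'D_v f y = w) ->
  exists H : 'M[R]_(p, S), H *m jacobian f y = 1%:M.
Proof.
move=> df surj; have /choice[v vP] := fun i : 'I_p => surj (delta_mx 0 i).
exists (\matrix_i v i); apply/row_matrixP => i.
by rewrite row_mul rowK -deriveEjacobian// vP row1.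
Qed.

Lemma tangent_jacobian (U : set 'rV[R]_S) p (f : 'rV[R]_S -> 'rV[R]_p) y v :
  open U -> U y -> differentiable f y -> (forall y, U y -> M y -> f y = 0) ->
  tangent M y v -> v *m jacobian f y = 0.
Proof.
move=> oU Uy df fM [g [g0 gM dg gv]].
rewrite -deriveEjacobian// -gv -g0.
have := is_derive_along dg; rewrite g0 => /(_ _ f df) dfg.
apply: (is_derive_near_unique dfg (is_derive_cst (0 : 'rV[R]_p) (0 : R) 1)).
have gU : \forall t \near 0, U (g t).
  apply: (derivable_curve_continuous dg); rewrite g0.
  exact: open_nbhs_nbhs.
near=> t; rewrite /= fM//; near: t; [exact: gU|exact: gM].
Unshelve. all: by end_near. Qed.

(** [H] inverts the jacobian at [x0] only. Being constant, it later yields the left inverse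
    [(H J)^-1 H] at nearby points, which varies continuously; the inverses chosen at the other
    points [y] serve only to identify the tangent space. *)
Lemma local_equation x0 : embedded_submanifold n M -> M x0 ->
  exists (U : set 'rV[R]_S) (f : 'rV[R]_S -> 'rV[R]_(S - n)) (H : 'M[R]_(S - n, S)),
    [/\ open U, U x0, smooth f, H *m jacobian f x0 = 1%:M &
      forall y, U y -> M y -> forall v, tangent M y v <-> v *m jacobian f y = 0].
Proof.
move=> [_ emb] Mx0; have [U [f [oU Ux0 sf fM surj]]] := emb _ Mx0.
have [df cf] := smooth_C1 sf.
have [H HJ] := jacobian_left_inverse (df x0) (surj _ Ux0 Mx0).
exists U, f, H; split => // y Uy My v; split => [|vJ].
  apply: (tangent_jacobian oU Uy (df y)) => z Uz; exact: (fM z Uz).1.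
have [Hy HJy] := jacobian_left_inverse (df y) (surj _ Uy My).
have [g [g0 gf dg gv]] := level_set_curve df cf ((fM y Uy).1 My) HJy vJ.
exists g; split => //.
have gU : \forall t \near 0, U (g t).
  apply: (derivable_curve_continuous dg); rewrite g0.
  exact: open_nbhs_nbhs.
near=> t; apply/fM; near: t; [exact: gU|exact: gf].
Unshelve. all: by end_near. Qed.

End LocalGeometry.

(** * Derivative of the projection along tangent vectors *)

Section ProjectionDerivative.
Variables (R : realType) (S : nat) (M : set 'rV[R]_S) (Q : 'rV[R]_S -> 'M[R]_S).
Hypothesis projQ : forall x, M x -> orth_proj_onto (Q x) (tangent M x).
Hypothesis diffQ : forall x, M x -> differentiable (Q : RV R S -> 'M[R]_S) x.

Lemma derive_linear (V W : normedModType R) (f : V -> W) x (I : Type) (r : seq I)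
   (c : I -> R) (v : I -> V) : differentiable f x ->
  'D_(\sum_(i <- r) c i *: v i) f x = \sum_(i <- r) c i *: 'D_(v i) f x.
Proof.
move=> df; rewrite deriveE// linear_sum; apply: eq_bigr => i _.
by rewrite linearZ deriveE.
Qed.

Lemma derive_row (W : normedModType R) (f : 'rV[R]_S -> W) x (v : 'rV[R]_S) :
  differentiable f x ->
  'D_v f x = \sum_q v 0 q *: 'D_(delta_mx 0 q) f x.
Proof.
by move=> df; rewrite -(derive_linear _ _ _ df) -row_sum_delta.
Qed.

Lemma derive_proj_along x v : M x -> tangent M x v ->
  exists g : R -> 'rV[R]_S, [/\ g 0 = x, \forall t \near 0, M (g t), derivable g 0 1,
    'D_1 g 0 = v & is_derive 0 (1 : R) (Q \o g) ('D_v Q x)].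
Proof.
move=> Mx [g [g0 gM dg gv]]; exists g; split => //.
by have := is_derive_along (F := Q) dg; rewrite g0 gv; apply; exact: diffQ.
Qed.

Lemma derive_proj_tr x v : M x -> tangent M x v -> ('D_v Q x)^T = 'D_v Q x.
Proof.
move=> Mx Tv; have [g [g0 gM dg gv dQg]] := derive_proj_along Mx Tv.
apply: (@is_derive_near_unique _ _ (fun t => (Q (g t))^T) (Q \o g) 0) => //.
  apply: is_derive_mx => i j; rewrite mxE.
  under eq_fun do rewrite mxE.
  exact: (is_derive_mx_coord j i dQg).
by near=> t; have [] := projQ (x := g t); first by near: t.
Unshelve. all: by end_near. Qed.

Lemma derive_proj_idem x v : M x -> tangent M x v ->
  'D_v Q x *m Q x + Q x *m 'D_v Q x = 'D_v Q x.
Proof.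
move=> Mx Tv; have [g [g0 gM dg gv dQg]] := derive_proj_along Mx Tv.
have := is_derive_mulmx dQg dQg; rewrite /= g0 => dQQ.
apply: (is_derive_near_unique dQQ dQg).
by near=> t; have [] := projQ (x := g t); first by near: t.
Unshelve. all: by end_near. Qed.

(** Multiplying the differentiated identity [Q^2 = Q] by [Q] on both sides gives twice this product
    equal to itself. *)
Lemma proj_derive_proj x v : M x -> tangent M x v -> Q x *m 'D_v Q x *m Q x = 0.
Proof.
move=> Mx Tv; have [_ QQ _ _] := projQ Mx.
have := congr1 (fun A => Q x *m A *m Q x) (derive_proj_idem Mx Tv).
rewrite /= mulmxDr mulmxDl !mulmxA QQ -[_ *m Q x *m Q x]mulmxA QQ.
by move/eqP; rewrite -subr_eq0 addrK => /eqP.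
Qed.

End ProjectionDerivative.

(** * Continuity of the tensor K on the Grassmann bundle *)

Section GrassmannBundle.
Variables (R : realType) (S n m : nat) (M N : set 'rV[R]_S) (Q : 'rV[R]_S -> 'M[R]_S).
Hypothesis embM : embedded_submanifold n M.
Hypothesis NM : N `<=` M.
Hypothesis projQ : forall x, M x -> orth_proj_onto (Q x) (tangent M x).
Hypothesis diffQ : forall x, M x -> differentiable (Q : RV R S -> 'M[R]_S) x.

Local Notation G := (Gm M N m).

Lemma Gm_base z : G z -> M z.1.
Proof. by case=> /NM. Qed.

Lemma Gm_tr z : G z -> z.2^T = z.2.
Proof. by case=> _ []. Qed.

Lemma Gm_idem z : G z -> z.2 *m z.2 = z.2.
Proof. by case=> _ []. Qed.

Lemma Gm_row z i : G z -> tangent M z.1 (row i z.2).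
Proof. by case=> _ _ h; rewrite rowE; exact: h. Qed.

Lemma Gm_mulQ z : G z -> z.2 *m Q z.1 = z.2.
Proof.
move=> Gz; have [_ _ _ TQ] := projQ (Gm_base Gz).
by apply/row_matrixP => i; rewrite row_mul TQ//; exact: Gm_row.
Qed.

Lemma Gm_Qmul z : G z -> Q z.1 *m z.2 = z.2.
Proof.
move=> Gz; have [Qs _ _ _] := projQ (Gm_base Gz).
by apply: trmx_inj; rewrite trmx_mul Qs Gm_tr// Gm_mulQ.
Qed.

(* [proj_deriv z i k j] is [P_lj P_iq d_{x_q} Q_kl (x)]. *)
Definition proj_deriv (z : GX R S) (i : 'I_S) : 'M[R]_S :=
  'D_(row i z.2) Q z.1 *m z.2.

Lemma proj_derivE z i k j : G z ->
  \sum_l \sum_q z.2 l j * z.2 i q * ('D_(delta_mx 0 q) Q z.1) k l = proj_deriv z i k j.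
Proof.
move=> Gz; rewrite mxE; apply: eq_bigr => l _.
rewrite (derive_row (row i z.2) (diffQ (Gm_base Gz))) summxE mulr_suml.
by apply: eq_bigr => q _; rewrite !mxE; ring.
Qed.

(** Since [P Q = P = Q P], the product [P (D Q) P] contains the vanishing factor [Q (D Q) Q]. *)
Lemma mul_proj_deriv z i : G z -> z.2 *m proj_deriv z i = 0.
Proof.
move=> Gz; have QQQ := proj_derive_proj projQ diffQ (Gm_base Gz) (Gm_row i Gz).
transitivity (z.2 *m (Q z.1 *m 'D_(row i z.2) Q z.1 *m Q z.1) *m z.2).
  by rewrite !mulmxA Gm_mulQ// -!mulmxA Gm_Qmul.
by rewrite QQQ mulmx0 mul0mx.
Qed.

Definition jac_deriv p (f : 'rV[R]_S -> 'rV[R]_p) (v x : 'rV[R]_S) : 'M[R]_(S, p) :=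
  \matrix_(q < S, k < p) ('D_v ('D_(delta_mx 0 q) f) x) 0 k.

(** Expanding [v] leaves second derivatives in fixed directions, known to be continuous in [x], and
    makes joint continuity in [(x, v)] visible. *)
Lemma jac_derivE p (f : 'rV[R]_S -> 'rV[R]_p) v x q k :
  differentiable ('D_(delta_mx 0 q) f) x ->
  jac_deriv f v x q k = \sum_r v 0 r * ('D_(delta_mx 0 r) ('D_(delta_mx 0 q) f) x) 0 k.
Proof.
by move=> df; rewrite mxE derive_row// summxE; apply: eq_bigr => r _; rewrite mxE.
Qed.

(* Differentiating [Q J = 0] and [Q^2 = Q] along a curve in [M], with
   [1 - Q = J J' (1 - Q)] for any left inverse [J'] of the jacobian [J]. *)
Lemma mul_derive_proj (U : set 'rV[R]_S) p (f : 'rV[R]_S -> 'rV[R]_p) x v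
    (P : 'M[R]_S) (J' : 'M[R]_(p, S)) :
  open U -> U x -> M x -> smooth f ->
  (forall y, U y -> M y -> forall v, tangent M y v <-> v *m jacobian f y = 0) ->
  tangent M x v -> P *m Q x = P -> J' *m jacobian f x = 1%:M ->
  P *m 'D_v Q x = - (P *m jac_deriv f v x *m J' *m (1%:M - Q x)).
Proof.
move=> oU Ux Mx sf TJ Tv PQ J'J.
have [df _] := smooth_C1 sf; have [d2f _] := smooth_C2 sf.
have QJ y : U y -> M y -> Q y *m jacobian f y = 0.
  move=> Uy My; have [_ _ TQ _] := projQ My; apply/row_matrixP => i.
  by rewrite row_mul row0; apply/TJ => //; rewrite rowE; exact: TQ.
have [g [g0 gM dg gv dQg]] := derive_proj_along diffQ Mx Tv.
have dJg : is_derive 0 (1 : R) (fun t => jacobian f (g t)) (jac_deriv f v x).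
  apply: is_derive_mx => q k; rewrite mxE.
  rewrite (_ : (fun t => _) = (fun t => ('D_(delta_mx 0 q) f \o g) t 0 k)).
    by apply: is_derive_mx_coord; have := is_derive_along (F := 'D_(delta_mx 0 q) f) dg;
      rewrite g0 gv; apply; exact: d2f.
  by apply/funext => t; rewrite /= deriveE// mxE.
have gU : \forall t \near 0, U (g t).
  apply: (derivable_curve_continuous dg); rewrite g0; exact: open_nbhs_nbhs.
have DQJ : 'D_v Q x *m jacobian f x = - (Q x *m jac_deriv f v x).
  have := is_derive_mulmx dQg dJg; rewrite /= g0 => dQJ.
  apply/eqP; rewrite -subr_eq0 opprK; apply/eqP.
  apply: (is_derive_near_unique dQJ (is_derive_cst (0 : 'M[R]_(S, p)) (0 : R) 1)).
  by near=> t; rewrite QJ//; near: t.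
have [_ QQ _ TQ] := projQ Mx.
move: (jacobian f x) (QJ x Ux Mx) J'J DQJ (TJ x Ux Mx) => J QJ0 J'J DQJ TJx.
(* The rows of [1 - J J'] annihilate [J], hence are tangent, hence are fixed by [Q]. *)
have JQ : (1%:M - J *m J') *m Q x = 1%:M - J *m J'.
  apply/row_matrixP => i; rewrite row_mul TQ//; apply/TJx.
  by rewrite -row_mul mulmxBl mul1mx -mulmxA J'J mulmx1 subrr row0.
have QE : 1%:M - Q x = J *m J' *m (1%:M - Q x).
  apply/eqP; rewrite -subr_eq0 -{1}[1%:M - Q x]mul1mx -mulmxBl.
  by rewrite mulmxBr mulmx1 JQ subrr.
have QDQ := proj_derive_proj projQ diffQ Mx Tv.
(* The factor [1 - Q] can be inserted because [P = P Q] and [Q (D Q) Q = 0]. *)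
have PD : P *m 'D_v Q x = P *m 'D_v Q x *m (1%:M - Q x).
  have PDQ : P *m 'D_v Q x *m Q x = 0.
    transitivity (P *m (Q x *m 'D_v Q x *m Q x)); last by rewrite QDQ mulmx0.
    by rewrite !mulmxA PQ.
  by rewrite mulmxBr mulmx1 PDQ subr0.
rewrite PD {1}QE !mulmxA -[P *m _ *m J]mulmxA DQJ mulmxN !mulmxA PQ.
by rewrite !mulNmx.
Unshelve. all: by end_near. Qed.

(** The right-hand side of [mul_derive_proj] for the left inverse [(H J)^-1 H]. It involves [Q] but
    no derivative of [Q], and is defined at every pair [(x, P)]. *)
Definition normal_part p (f : 'rV[R]_S -> 'rV[R]_p) (H : 'M[R]_(p, S)) i
    (x : 'rV[R]_S) (P : 'M[R]_S) : 'M[R]_S :=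
  - (P *m jac_deriv f (row i P) x *m (invmx (H *m jacobian f x) *m H) *m (1%:M - Q x)).

Lemma cvg_normal_part (T : Type) (F : set_system T) (FF : Filter F) p
    (f : 'rV[R]_S -> 'rV[R]_p) (H : 'M[R]_(p, S)) i
    (X : T -> 'rV[R]_S) (P : T -> 'M[R]_S) (x0 : 'rV[R]_S) (P0 : 'M[R]_S) :
  smooth f -> H *m jacobian f x0 = 1%:M -> M x0 -> X @ F --> x0 -> P @ F --> P0 ->
  (fun t => normal_part f H i (X t) (P t)) @ F --> normal_part f H i x0 P0.
Proof.
move=> sf HJ Mx0 c1 c2.
have [df cf] := smooth_C1 sf; have [d2f c2f] := smooth_C2 sf.
have cHJ : (fun t => H *m jacobian f (X t)) @ F --> H *m jacobian f x0.
  apply: cvg_mulmx; first exact: cvg_cst.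
  by apply: (@continuous_cvg _ _ _ F FF X (jacobian f) x0) => //; exact: jacobian_continuous.
have uHJ : H *m jacobian f x0 \in unitmx by rewrite HJ unitmx1.
have crow : (fun t => row i (P t)) @ F --> row i P0.
  by rewrite rowE; under eq_fun do rewrite rowE; apply: cvg_mulmx; first exact: cvg_cst.
have cjac : (fun t => jac_deriv f (row i (P t)) (X t)) @ F --> jac_deriv f (row i P0) x0.
  apply: mx_cvgP => q l.
  pose b (x v : 'rV[R]_S) : R :=
    \sum_r v 0 r * ('D_(delta_mx 0 r) ('D_(delta_mx 0 q) f) x) 0 l.
  have ab x v : jac_deriv f v x q l = b x v by apply: jac_derivE; exact: d2f.
  have -> : (fun t => jac_deriv f (row i (P t)) (X t) q l) =
      fun t => b (X t) (row i (P t)) by apply/funext => t; exact: ab.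
  rewrite (ab x0 (row i P0)) /b.
  apply: cvg_fsum => r _; apply: cvgM; first exact: cvg_mx_coord crow.
  apply: cvg_mx_coord.
  apply: (@continuous_cvg _ _ _ F FF X ('D_(delta_mx 0 r) ('D_(delta_mx 0 q) f)) x0) => //; exact: c2f.
apply: cvgN; apply: cvg_mulmx; [apply: cvg_mulmx; [apply: cvg_mulmx|]|].
- exact: c2.
- exact: cjac.
- apply: cvg_mulmx; last exact: cvg_cst.
  exact: cvg_invmx cHJ.
- apply: cvgB; first exact: cvg_cst.
  apply: (@continuous_cvg _ _ _ F FF X Q x0) => //; exact: differentiable_continuous (diffQ Mx0).
Qed.

Lemma proj_deriv_continuous i k j :
  {within G, continuous (fun z : GX R S => proj_deriv z i k j)}.
Proof.
apply/subspace_continuousP => z0 Gz0.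
have Mz0 := Gm_base Gz0.
have [U [f [H [oU Uz0 sf HJ TJ]]]] := local_equation embM Mz0.
have [df cf] := smooth_C1 sf.
have KE z : G z -> U z.1 -> H *m jacobian f z.1 \in unitmx ->
    proj_deriv z i k j = normal_part f H i z.1 z.2 j k.
  move=> Gz Uz uz.
  have J'J : (invmx (H *m jacobian f z.1) *m H) *m jacobian f z.1 = 1%:M.
    by rewrite -mulmxA mulVmx.
  rewrite /normal_part.
  rewrite -(mul_derive_proj oU Uz (Gm_base Gz) sf TJ (Gm_row i Gz) (Gm_mulQ Gz) J'J).
  (* The formula gives [P (D Q)], while [proj_deriv] is [(D Q) P]; both factors are symmetric, so
     transposition exchanges them, and with them the indices [k] and [j]. *)
  have -> : z.2 *m 'D_(row i z.2) Q z.1 = (proj_deriv z i)^T.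
    rewrite /proj_deriv trmx_mul Gm_tr//.
    by rewrite (derive_proj_tr projQ diffQ (Gm_base Gz) (Gm_row i Gz)).
  by rewrite [RHS]mxE.
have c1 : (fun z : GX R S => z.1) @ z0 --> z0.1 by exact: cvg_fst.
have c2 : (fun z : GX R S => z.2) @ z0 --> z0.2 by exact: cvg_snd.
have nU : \forall z \near z0, U z.1 by apply: c1; exact: open_nbhs_nbhs.
have nu : \forall z \near z0, H *m jacobian f z.1 \in unitmx.
  have cHJ : (fun z : GX R S => \det (H *m jacobian f z.1)) @ z0 --> \det (H *m jacobian f z0.1).
    apply: cvg_det; apply: cvg_mulmx; first exact: cvg_cst.
    by apply: (@continuous_cvg _ _ _ (nbhs z0) _ (fun z => z.1) (jacobian f) z0.1) => //; exact: jacobian_continuous.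
  have : \det (H *m jacobian f z0.1) != 0 by rewrite HJ det1 oner_eq0.
  move/cvgr_neq0 : cHJ => /[apply].
  by apply: filterS => z; rewrite unitmxE unitfE.
have cE := @cvg_normal_part _ (nbhs z0) _ _ f H i _ _ _ _ sf HJ Mz0 c1 c2.
have e0 : proj_deriv z0 i k j = normal_part f H i z0.1 z0.2 j k.
  by apply: KE => //; rewrite HJ unitmx1.
rewrite /from_subspace e0.
apply: (@cvg_trans _ ((fun z => normal_part f H i z.1 z.2 j k) @ within G (nbhs z0))).
  apply: near_eq_cvg; rewrite near_withinE; near=> z => Gz.
  by rewrite KE//; near: z.
apply: cvg_within_filter.
exact: (@cvg_mx_coord _ _ _ (nbhs_filter z0) _ _ _ _ j k (cE (nbhs_filter z0))).
Unshelve. all: by end_near. Qed.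

End GrassmannBundle.

(** * Compactness of the Grassmann bundle *)

Lemma mx_ball_compact (R : realType) m n (r : R) : compact [set A : 'M[R]_(m, n) | `|A| <= r].
Proof.
have -> : [set A : 'M[R]_(m, n) | `|A| <= r] = vec_mx @` [set v : 'rV[R]_(m * n) | `|v| <= r].
  apply/seteqP; split => [A /= Ar|_ [v vr <-]].
    exists (mxvec A); last exact: mxvecK.
    apply: mx_norm_le => [|i j]; first exact: le_trans (normr_ge0 A) Ar.
    rewrite (ord1 i); case/mxvec_indexP: j => k l; rewrite mxvecE.
    exact: le_trans (mx_coord_le _ _ _) Ar.
  apply: mx_norm_le => [|i j]; first exact: le_trans (normr_ge0 v) vr.
  by rewrite mxE; exact: le_trans (mx_coord_le _ _ _) vr.
apply: continuous_compact.
  apply: continuous_subspaceT => v; apply: (@mx_cvgP _ _ (nbhs v)) => i j.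
  rewrite mxE; under eq_fun do rewrite mxE.
  exact: coord_continuous.
apply: bounded_closed_compact.
  by exists r; split => [|x rx v /= vr]; [exact: num_real|rewrite (le_trans vr)// ltW].
apply: (@closed_comp _ _ (fun u : 'rV[R]_(m * n) => `|u|) [set x | x <= r]); last exact: closed_le.
by move=> x _; exact: norm_continuous.
Qed.

(** A rank factorization [P = C D] of an idempotent satisfies [D C = 1]. The trace is continuous
    where the rank is not, so this lets the condition on the rank pass to limits. *)
Lemma mxtrace_idem (R : fieldType) n (P : 'M[R]_n) : P *m P = P -> \tr P = (\rank P)%:R.
Proof.
move=> PP; move: (mulmx_base P) (row_base_free P) (col_base_full P).
move: (col_base P) (row_base P) => C D CD freeD fullC.
have DC : D *m C = 1%:M.
  apply: (row_free_inj freeD); apply: (row_full_inj fullC).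
  by rewrite /= mul1mx !mulmxA CD -mulmxA CD PP.
by rewrite -{1}CD mxtrace_mulC DC mxtrace1.
Qed.

(** The diagonal entry [P_ii] is the sum of the squares of row [i]: it dominates its own square,
    hence is at most 1, and it dominates every [P_ij^2]. *)
Lemma proj_norm_le1 (R : realType) n (P : 'M[R]_n) : P^T = P -> P *m P = P -> `|P| <= 1.
Proof.
move=> Ps PP; apply: mx_norm_le => // i j.
have sym k l : P k l = P l k by rewrite -[in LHS]Ps mxE.
have Pi2 : P i i = \sum_k P i k ^+ 2.
  by rewrite -[in LHS]PP mxE; apply: eq_bigr => k _; rewrite (sym k) expr2.
have Pii k : P i k ^+ 2 <= P i i.
  by rewrite Pi2 (bigD1 k)//= lerDl; apply: sumr_ge0 => l _; exact: sqr_ge0.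
have Pi1 : P i i <= 1.
  have [Pi0|Pi0] := leP (P i i) 0; first exact: le_trans Pi0 ler01.
  by rewrite -(ler_pM2l Pi0) mulr1 -expr2.
rewrite -(@ler_pXn2r _ 2)// ?nnegrE// expr1n -normrX ger0_norm ?sqr_ge0//.
exact: le_trans (Pii j) Pi1.
Qed.

Section GrassmannCompact.
Variables (R : realType) (S n m : nat) (M N : set 'rV[R]_S) (Q : 'rV[R]_S -> 'M[R]_S).
Hypothesis NM : N `<=` M.
Hypothesis compactN : compact (N : set (RV R S)).
Hypothesis projQ : forall x, M x -> orth_proj_onto (Q x) (tangent M x).
Hypothesis diffQ : forall x, M x -> differentiable (Q : RV R S -> 'M[R]_S) x.

Local Notation G := (Gm M N m).

Let Rhaus (V : normedModType R) := @norm_hausdorff R V.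

(** Inclusion in the tangent space passes to the limit as the equation [P Q(x) = P], because [Q] is
    continuous at points of the manifold; the dimension passes to the limit as the trace. *)
Lemma Gm_closed : closed G.
Proof.
move=> z0 clz.
pose F := within G (nbhs z0).
have FF : ProperFilter F by exact: within_nbhs_proper.
have c1 : (fun z : GX R S => z.1) @ F --> z0.1 by apply: cvg_within_filter; exact: cvg_fst.
have c2 : (fun z : GX R S => z.2) @ F --> z0.2 by apply: cvg_within_filter; exact: cvg_snd.
have FG : \forall z \near F, G z by apply: withinT; exact: nbhs_filter.
have Nz0 : N z0.1.
  have clN : closed (N : set (RV R S)) by apply: compact_closed => //; exact: Rhaus.
  apply: (@closed_cvg (GX R S) (RV R S) F FF (fun z => z.1) N clN _ z0.1 c1).
  by apply: filterS FG => z [].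
have uniq p q (f g : GX R S -> 'M[R]_(p, q)) (a b : 'M[R]_(p, q)) : f @ F --> a -> g @ F --> b ->
    (\forall z \near F, f z = g z) -> a = b.
  move=> fa gb fg; rewrite -(cvg_lim (@Rhaus 'M[R]_(p, q)) fa).
  apply: (cvg_lim (@Rhaus 'M[R]_(p, q))); apply: cvg_trans gb; apply: near_eq_cvg.
  by apply: filterS fg => z ->.
have Q0 := projQ (NM Nz0).
have PP : z0.2 *m z0.2 = z0.2.
  apply: (uniq _ _ (fun z => z.2 *m z.2) (fun z => z.2)) => //; first exact: cvg_mulmx.
  by apply: filterS FG => z [_ [? ? ?] _].
have PQ : z0.2 *m Q z0.1 = z0.2.
  apply: (uniq _ _ (fun z => z.2 *m Q z.1) (fun z => z.2)) => //.
    apply: cvg_mulmx => //.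
    apply: (@continuous_cvg _ _ _ F _ (fun z => z.1) Q z0.1) => //.
    exact: differentiable_continuous (diffQ (NM Nz0)).
  by apply: filterS FG => z Gz; rewrite (Gm_mulQ NM projQ Gz).
split => //.
  split => //.
  - apply: (uniq _ _ (fun z => z.2^T) (fun z => z.2)) => //.
      apply: mx_cvgP => i j; rewrite mxE; under eq_fun do rewrite mxE.
      exact: cvg_mx_coord.
    by apply: filterS FG => z [_ [? ? ?] _].
  - have ct : (fun z : GX R S => \tr z.2) @ F --> \tr z0.2.
      by apply: cvg_fsum => i _; exact: cvg_mx_coord.
    have cm : (fun z : GX R S => \tr z.2) @ F --> (m%:R : R).
      apply: (@cvg_trans _ ((fun=> m%:R) @ F)); last exact: cvg_cst.
      apply: near_eq_cvg; apply: filterS FG => z [_ [_ zz <-] _].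
      by rewrite mxtrace_idem.
    have := cvg_lim (@Rhaus R^o) ct; rewrite (cvg_lim (@Rhaus R^o) cm).
    by rewrite mxtrace_idem// => h; apply/esym/eqP; rewrite -(eqr_nat R) h.
by move=> v; rewrite -PQ mulmxA; case: Q0 => _ _ h _; exact: h.
Qed.

Lemma Gm_compact : compact G.
Proof.
apply: (@subclosed_compact _ _ (N `*` [set A : 'M[R]_S | `|A| <= 1]) Gm_closed).
  by apply: compact_setX => //; exact: mx_ball_compact.
by move=> z [Nz [zt zz _] _]; split => //=; exact: proj_norm_le1.
Qed.

End GrassmannCompact.

(** * C^1 functions on the Grassmann bundle *)

Section C1.
Variables (R : realType) (V : normedModType R).

Definition C1 (f : V -> R) : Prop :=
  (forall x, differentiable f x) /\ (forall v, continuous ('D_v f)).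

Lemma C1_continuous f : C1 f -> continuous f.
Proof. by move=> [df _] x; exact: differentiable_continuous. Qed.

Lemma deriveM_fun (f g : V -> R) v x : differentiable f x -> differentiable g x ->
  'D_v (fun x => f x * g x) x = f x * 'D_v g x + g x * 'D_v f x.
Proof. by move=> df dg; rewrite (@deriveM _ _ f g)//; exact: diff_derivable. Qed.

Lemma C1M f g : C1 f -> C1 g -> C1 (fun x => f x * g x).
Proof.
move=> Cf Cg; have [[df cf] [dg cg]] := (Cf, Cg); split => [x|v].
  exact: (@differentiableM _ _ f g).
rewrite (_ : 'D_v _ = fun x => f x * 'D_v g x + g x * 'D_v f x); last first.
  by apply/funext => x; exact: deriveM_fun.
move=> x; apply: cvgD; apply: cvgM.
- exact: C1_continuous.
- exact: cg.
- exact: C1_continuous.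
- exact: cf.
Qed.

Lemma derive_fsum n (f : 'I_n -> V -> R) v x : (forall i, differentiable (f i) x) ->
  'D_v (fun x => \sum_i f i x) x = \sum_i 'D_v (f i) x.
Proof.
move=> df; rewrite -(@derive_sum _ _ _ n f); last by move=> i; exact: diff_derivable.
by congr ('D_v _ x); apply/funext => y; rewrite fct_sumE.
Qed.

Lemma C1_sum n (f : 'I_n -> V -> R) : (forall i, C1 (f i)) -> C1 (fun x => \sum_i f i x).
Proof.
move=> Cf; split => [x|v].
  rewrite (_ : (fun x => _) = \sum_i f i); last by apply/funext => y; rewrite fct_sumE.
  by apply: differentiable_sum => i; case: (Cf i).
rewrite (_ : 'D_v _ = fun x => \sum_i 'D_v (f i) x); last first.
  by apply/funext => x; apply: derive_fsum => i; case: (Cf i).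
by move=> x; apply: cvg_fsum => i _; case: (Cf i) => _; apply.
Qed.

Lemma C1B f g : C1 f -> C1 g -> C1 (fun x => f x - g x).
Proof.
move=> Cf Cg; have [[df cf] [dg cg]] := (Cf, Cg); split => [x|v].
  exact: (@differentiableB _ _ _ f g).
rewrite (_ : 'D_v _ = fun x => 'D_v f x - 'D_v g x).
  by move=> x; apply: cvgB; [exact: cf|exact: cg].
by apply/funext => x; rewrite (@deriveB _ _ _ f g)//; exact: diff_derivable.
Qed.

Lemma differentiable_mx m n (f : V -> 'M[R]_(m, n)) x :
  (forall i j, differentiable (fun x => f x i j) x) -> differentiable f x.
Proof.
move=> df.
have -> : f = \sum_i \sum_j (fun x => f x i j *: delta_mx i j).
  apply/funext => y; rewrite fct_sumE [LHS]matrix_sum_delta.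
  by apply: eq_bigr => i _; rewrite fct_sumE.
apply: differentiable_sum => i; apply: differentiable_sum => j.
exact: (differentiableZl (delta_mx i j) (df i j)).
Qed.

End C1.

Section BundleCalculus.
Variables (R : realType) (S : nat).
Implicit Types (z v : GX R S) (f : GX R S -> R).

Lemma derive_coord2 i j v z : 'D_v (fun z : GX R S => z.2 i j) z = v.2 i j.
Proof.
apply: cvg_lim => //.
apply: (@cvg_trans _ ((fun=> v.2 i j) @ (0 : R)^')); last exact: cvg_cst.
apply: near_eq_cvg; near=> h; have h0 : h != 0 by near: h; exact: nbhs_dnbhs_neq.
by rewrite /= !mxE addrK; apply/esym; exact: (mulKf h0).
Unshelve. all: by end_near. Qed.

Lemma C1_coord2 i j : C1 (fun z : GX R S => z.2 i j).
Proof.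
split => [z|v].
  apply: (@differentiable_comp _ _ _ _ snd (fun N : 'M[R]_S => N i j)).
    apply: (@linear_differentiable R ('rV[R]_S * 'M[R]_S)%type 'M[R]_S snd) => x.
  exact: cvg_snd.
  exact: differentiable_coord.
rewrite (_ : 'D_v _ = fun=> v.2 i j); first by move=> z; exact: cvg_cst.
by apply/funext => z; exact: derive_coord2.
Qed.

Lemma derive_split f z (x : 'rV[R]_S) (X : 'M[R]_S) : differentiable f z ->
  'D_((x, X) : GX R S) f z = 'D_((x, 0) : GX R S) f z + \sum_j \sum_k X j k * DP j k f z.
Proof.
move=> df; rewrite /DP.
have -> : (x, X) = (x, 0) + \sum_j \sum_k X j k *: ((0, delta_mx j k) : GX R S).
  apply/pair_eqP/andP; split; apply/eqP => /=.
    rewrite (big_morph fst (id1 := 0) (op1 := +%R))//= big1 ?addr0// => j _.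
    rewrite (big_morph fst (id1 := 0) (op1 := +%R))//= big1// => k _.
    by rewrite scaler0.
  rewrite (big_morph snd (id1 := 0) (op1 := +%R))//= add0r {1}(matrix_sum_delta X).
  by apply: eq_bigr => j _; rewrite (big_morph snd (id1 := 0) (op1 := +%R)).
rewrite !deriveE// linearD linear_sum; congr (_ + _); apply: eq_bigr => j _.
by rewrite linear_sum; apply: eq_bigr => k _; rewrite linearZ deriveE.
Qed.

End BundleCalculus.

(** * The substitution of P P^T for P *)

Section GramMap.
Variables (R : realType) (S : nat).
Implicit Types (z v : GX R S) (f : GX R S -> R).

Lemma C1cE f : C1c f <-> C1 f /\ compact (closure [set z | f z != 0]).
Proof. by split => [[d c k]|[[d c] k]]; split. Qed.

Lemma compact_support_sub f (K : set (GX R S)) : compact K -> closed K ->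
  [set z | f z != 0] `<=` K -> compact (closure [set z | f z != 0]).
Proof.
move=> cK clK fK; apply: subclosed_compact cK _; first exact: closed_closure.
by rewrite [X in _ `<=` X](closure_id K).1//; exact: closureS.
Qed.

Lemma C1cM f g : C1c f -> C1 g -> C1c (fun z => f z * g z).
Proof.
move=> /C1cE[Cf kf] Cg; apply/C1cE; split; first exact: C1M.
apply: (compact_support_sub kf); first exact: closed_closure.
by move=> z /= fg; apply: subset_closure => /=; apply: contra_neq fg => ->; rewrite mul0r.
Qed.

Definition gram z : 'M[R]_S := z.2 *m z.2^T.

Definition gram_deriv z (X : 'M[R]_S) : 'M[R]_S := X *m z.2^T + z.2 *m X^T.

(** Every point of the Grassmann bundle is fixed, since [P P^T = P] there, but the derivative
    replaces a direction [X] by [X P^T + P X^T]. Composition with it thus changes only the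
    derivatives of a test function on the bundle, not its values. *)
Definition gram_map z : GX R S := (z.1, gram z).

Let gramE i j z : gram z i j = \sum_k z.2 i k * z.2 j k.
Proof. by rewrite mxE; apply: eq_bigr => k _; rewrite mxE. Qed.

Lemma C1_gram i j : C1 (fun z => gram z i j).
Proof.
rewrite (_ : (fun z => _) = fun z => \sum_k z.2 i k * z.2 j k); last first.
  by apply/funext => z; exact: gramE.
by apply: C1_sum => k; apply: C1M; exact: C1_coord2.
Qed.

Lemma derive_gram i j v z : 'D_v (fun z => gram z i j) z = gram_deriv z v.2 i j.
Proof.
rewrite (_ : (fun z => _) = fun z => \sum_k z.2 i k * z.2 j k); last first.
  by apply/funext => y; exact: gramE.
have C1z a b : differentiable (fun z : GX R S => z.2 a b) z by case: (C1_coord2 R a b).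
rewrite derive_fsum; last by move=> k; apply: (@differentiableM _ _ (fun z : GX R S => z.2 i k)).
rewrite !mxE -big_split/=; apply: eq_bigr => k _.
by rewrite deriveM_fun// !derive_coord2 !mxE addrC mulrC [_ * z.2 j k]mulrC; ring.
Qed.

Lemma gram_derivE z X i j :
  gram_deriv z X i j = \sum_k (X i k * z.2 j k + z.2 i k * X j k).
Proof. by rewrite !mxE -big_split; apply: eq_bigr => k _; rewrite !mxE. Qed.

Lemma differentiable_gram z : differentiable gram z.
Proof. by apply: differentiable_mx => i j; case: (C1_gram i j). Qed.

Lemma differentiable_gram_map z : differentiable gram_map z.
Proof.
apply: differentiable_pair; last exact: differentiable_gram.
apply: (@linear_differentiable R ('rV[R]_S * 'M[R]_S)%type 'rV[R]_S fst) => x.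
exact: cvg_fst.
Qed.

Lemma derive_gram_map v z : 'D_v gram_map z = (v.1, gram_deriv z v.2).
Proof.
have dg := differentiable_gram z.
have df : differentiable (fst : GX R S -> 'rV[R]_S) z.
  apply: (@linear_differentiable R ('rV[R]_S * 'M[R]_S)%type 'rV[R]_S fst) => x.
  exact: cvg_fst.
rewrite deriveE; last exact: differentiable_gram_map.
rewrite (@diff_pair _ _ _ _ fst gram)//=.
rewrite (@diff_lin R ('rV[R]_S * 'M[R]_S)%type 'rV[R]_S fst); last by move=> x; exact: cvg_fst.
congr (_, _); rewrite -deriveE// derive_mx; last exact: diff_derivable.
by apply/matrixP => i j; rewrite mxE derive_gram.
Qed.

Lemma derive_comp_gram_map f v z : differentiable f (gram_map z) ->
  'D_v (f \o gram_map) z = 'D_((v.1, gram_deriv z v.2) : GX R S) f (gram_map z).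
Proof.
move=> df; have dg := differentiable_gram_map z.
have dfg : differentiable (f \o gram_map) z by exact: differentiable_comp.
have dT : 'd gram_map z v = (v.1, gram_deriv z v.2).
  by rewrite -(derive_gram_map v z); apply/esym; exact: deriveE.
apply: etrans (deriveE _ dfg) _; apply: etrans; last exact: esym (deriveE _ df).
by rewrite -dT; exact: (congr1 (fun g => g v) (diff_comp dg df)).
Qed.

Lemma C1_comp_gram_map f : C1 f -> C1 (f \o gram_map).
Proof.
move=> [df cf]; split => [z|v].
  by apply: differentiable_comp => //; exact: differentiable_gram_map.
rewrite (_ : 'D_v _ = fun z => 'D_((v.1, 0) : GX R S) f (gram_map z) +
    \sum_j \sum_k gram_deriv z v.2 j k * DP j k f (gram_map z)); last first.
  by apply/funext => z; rewrite derive_comp_gram_map// derive_split.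
move=> z; have cT : gram_map @ nbhs z --> gram_map z.
  exact: (differentiable_continuous (differentiable_gram_map z)).
have cTf (g : GX R S -> R) : continuous g -> (fun z => g (gram_map z)) @ nbhs z --> g (gram_map z).
  by move=> cg; apply: (@continuous_cvg _ _ _ (nbhs z) _ gram_map g) => //; exact: cg.
have c2 a b : (fun z : GX R S => z.2 a b) @ nbhs z --> z.2 a b.
  exact: (C1_continuous (C1_coord2 R a b)).
apply: cvgD; first by apply: (cTf ('D_((v.1, 0) : GX R S) f)); exact: cf.
apply: (@cvg_fsum _ _ (nbhs z)) => j _; apply: (@cvg_fsum _ _ (nbhs z)) => k _.
apply: cvgM; last first.
  by apply: (cTf (DP j k f)); exact: cf.
rewrite (_ : (fun t => _) = fun t : GX R S => \sum_l (v.2 j l * t.2 k l + t.2 j l * v.2 k l)).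
  rewrite gram_derivE; apply: (@cvg_fsum _ _ (nbhs z)) => l _.
  by apply: cvgD; apply: cvgM; first [exact: cvg_cst | exact: c2].
by apply/funext => t; exact: gram_derivE.
Qed.

(** Compact support survives because the map is proper: the diagonal entries of [P P^T] are sums of
    squares and control every entry of [P]. *)
Lemma C1c_comp_gram_map f : C1c f -> C1c (f \o gram_map).
Proof.
move=> /C1cE[Cf kf]; apply/C1cE; split; first exact: C1_comp_gram_map.
set K := closure _ in kf.
have clK : closed K by exact: closed_closure.
have [r [r0 Kr]] : exists r : R, 0 <= r /\ forall z, K z -> `|z.1| <= r /\ `|z.2| <= r.
  have [M [Mr KM]] := compact_bounded kf.
  exists (`|M| + 1); split => // z Kz.
  have zM : `|z| <= `|M| + 1.
    by apply: KM => //; rewrite (le_lt_trans (ler_norm _))// ltrDl.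
  by move: zM; rewrite prod_normE ge_max => /andP.
(* An entry whose square is at most [r] is at most [r + 1] in absolute value; this avoids square
   roots. *)
pose K' : set (GX R S) := [set x | `|x| <= r] `*` [set X | `|X| <= r + 1].
have cK' : compact K' by apply: compact_setX; exact: mx_ball_compact.
apply: (compact_support_sub cK').
  by apply: compact_closed => //; exact: norm_hausdorff.
move=> z /= fz; have /Kr[/= z1 z2] : K (gram_map z) by exact: subset_closure.
split => //=; apply: mx_norm_le => [|i j]; first by rewrite addr_ge0.
have : z.2 i j ^+ 2 <= r.
  apply: le_trans z2; apply: le_trans (mx_coord_le _ i i).
  rewrite gramE (bigD1 j)//= ger0_norm.
    by rewrite expr2 lerDl; apply: sumr_ge0 => k _; rewrite -expr2 sqr_ge0.
  by rewrite addr_ge0 -?expr2 ?sqr_ge0//; apply: sumr_ge0 => k _; rewrite -expr2 sqr_ge0.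
move=> zr; rewrite leNgt; apply/negP => rz.
have : (r + 1) ^+ 2 <= `|z.2 i j| ^+ 2.
  by rewrite ler_pXn2r ?nnegrE ?addr_ge0// ltW.
by rewrite real_normK ?num_real//; nra.
Qed.

End GramMap.

(** * Integral identities for the generalized curvature *)

Section RintegralSum.
Variables (d : measure_display) (T : measurableType d) (R : realType).
Variables (mu : {measure set T -> \bar R}) (D : set T).
Hypothesis mD : measurable D.

Lemma integrable_fsum n (f : 'I_n -> T -> R) :
  (forall i, mu.-integrable D (EFin \o f i)) ->
  mu.-integrable D (EFin \o (fun x => \sum_i f i x)).
Proof.
move=> fi; have := @integrable_sum _ _ _ mu D mD _ (index_enum 'I_n) xpredT (fun i => EFin \o f i) (fun i _ => fi i).
by apply: eq_integrable => // x _; rewrite /= sumEFin.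
Qed.

Lemma integrableD_fun (f g : T -> R) :
  mu.-integrable D (EFin \o f) -> mu.-integrable D (EFin \o g) ->
  mu.-integrable D (EFin \o (fun x => f x + g x)).
Proof. by move=> fi gi; have := integrableD mD fi gi; apply: eq_integrable. Qed.

Lemma integrableN_fun (f : T -> R) :
  mu.-integrable D (EFin \o f) -> mu.-integrable D (EFin \o (fun x => - f x)).
Proof. by move=> fi; have := integrableN fi; apply: eq_integrable. Qed.

Lemma Rintegral_fsum n (f : 'I_n -> T -> R) :
  (forall i, mu.-integrable D (EFin \o f i)) ->
  \int[mu]_(x in D) (\sum_i f i x) = \sum_i \int[mu]_(x in D) f i x.
Proof.
elim: n f => [|n IH] f fi.
  under eq_Rintegral do rewrite big_ord0.
  by rewrite Rintegral_cst// mul0r big_ord0.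
under eq_Rintegral do rewrite big_ord_recr/=.
rewrite big_ord_recr/= RintegralD//; last first.
  by apply: integrable_fsum => i; exact: fi.
by congr (_ + _); apply: IH => i.
Qed.

End RintegralSum.

Section CurvatureIdentity.
Variables (R : realType) (S : nat) (G : set (GX R S)).
Variables (V : {measure set GXm R S -> \bar R}) (B : GX R S -> 'I_S -> 'I_S -> 'I_S -> R).
Hypothesis closedG : closed G.
Hypothesis compactG : compact G.
Hypothesis projG : forall z, G z -> z.2^T = z.2 /\ z.2 *m z.2 = z.2.
Hypothesis finV : (V setT < +oo)%E.
Hypothesis curvB : gen_curvature G V B.

Let mG : measurable (G : set (GXm R S)).
Proof. exact: borel_closed. Qed.

Let VG : (V (G : set (GXm R S)) < +oo)%E.
Proof. by apply: le_lt_trans finV; apply: le_measure; rewrite ?inE. Qed.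

Definition integrable_on (f : GX R S -> R) :=
  V.-integrable (G : set (GXm R S)) (EFin \o f).

Lemma within_integrable_on f : {within G, continuous f} -> integrable_on f.
Proof. exact: within_continuous_integrable. Qed.

Lemma integrable_onM f g : integrable_on f -> {within G, continuous g} ->
  integrable_on (fun z => f z * g z).
Proof.
move=> fi cg; have [M [M0 gM]] := within_bounded compactG cg.
have := @integrableMl _ _ _ V _ mG (EFin \o f) (g : GXm R S -> R) fi.
move=> /(_ (within_continuous_measurable cg)) H.
have : [bounded g x | x in (G : set (GXm R S))].
  by exists M; split; [exact: num_real|move=> x Mx y Gy /=; rewrite (le_trans (gM y Gy))// ltW].
by move=> /H; apply: eq_integrable.
Qed.

(** The tensor [C] is a parameter because the identity is used for [B], for its symmetrization and
    for the limit curvature. *)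
Definition curv_integrand (phi : GX R S -> R) (C : GX R S -> 'I_S -> 'I_S -> 'I_S -> R)
    (i : 'I_S) (z : GX R S) : R :=
  (\sum_j z.2 i j * Dx j phi z)
  + (\sum_j \sum_k C z i j k * DP j k phi z)
  + (\sum_j C z j i j * phi z).

Local Notation I f := (\int[V]_(z in (G : set (GXm R S))) f z).

Lemma coord2_within j k : {within G, continuous (fun z : GX R S => z.2 j k)}.
Proof. by apply: continuous_subspaceT; exact: C1_continuous (C1_coord2 R j k). Qed.

Lemma integrable_curv phi C i : C1c phi -> (forall i j k, integrable_on (fun z => C z i j k)) ->
  integrable_on (curv_integrand phi C i).
Proof.
move=> /C1cE[Cphi _] Ci; have cphi := C1_continuous Cphi; have [_ cD] := Cphi.
have wD v : {within G, continuous ('D_v phi)} by exact: continuous_subspaceT.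
apply: integrableD_fun => //; first (apply: integrableD_fun => //).
- apply: integrable_fsum => // j; apply: within_integrable_on.
  by move=> z; apply: cvgM; [exact: coord2_within|exact: wD].
- apply: integrable_fsum => // j; apply: integrable_fsum => // k.
  by apply: integrable_onM; [exact: Ci|exact: wD].
- apply: integrable_fsum => // j; apply: integrable_onM; [exact: Ci|].
  exact: continuous_subspaceT.
Qed.

Let integrableB i j k : integrable_on (fun z => B z i j k).
Proof. by case: curvB => h _; exact: h. Qed.

Let test phi i : C1c phi -> I (curv_integrand phi B i) = 0.
Proof. by move=> Cphi; case: curvB => _ h; rewrite /Rintegral h. Qed.

Definition curv_mx (z : GX R S) i : 'M[R]_S := \matrix_(j, k) B z i j k.

Definition sym_curv (z : GX R S) i j k : R := gram_deriv z (curv_mx z i) j k.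

Let gram_G z : G z -> gram z = z.2.
Proof. by move=> /projG[zt zz]; rewrite /gram zt zz. Qed.

Let contract phi i z : differentiable phi z ->
  \sum_j \sum_k B z i j k * DP j k phi z = 'D_((0, curv_mx z i) : GX R S) phi z.
Proof.
move=> df; rewrite derive_split// derive0 add0r.
by apply: eq_bigr => j _; apply: eq_bigr => k _; rewrite mxE.
Qed.

Lemma integrable_sym_curv i j k : integrable_on (fun z => sym_curv z i j k).
Proof.
have -> : (fun z => sym_curv z i j k) =
    (fun z => \sum_l (B z i j l * z.2 k l + B z i k l * z.2 j l)).
  apply/funext => z; rewrite /sym_curv gram_derivE; apply: eq_bigr => l _.
  by rewrite !mxE [z.2 j l * _]mulrC.
apply: integrable_fsum => // l; apply: integrableD_fun => //;
  by apply: integrable_onM => //; exact: coord2_within.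
Qed.

(* Test with [phi (P - P P^T)_ab], which vanishes on the Grassmannian. *)
Lemma curv_symmetrization phi i a b : C1c phi ->
  I (fun z => B z i a b * phi z) = I (fun z => sym_curv z i a b * phi z).
Proof.
move=> Cphi; pose h (z : GX R S) : R := z.2 a b - gram z a b.
have Ch : C1 h by apply: C1B; [exact: C1_coord2|exact: C1_gram].
have dh v z : 'D_v h z = v.2 a b - gram_deriv z v.2 a b.
  rewrite -(derive_coord2 a b v z) -derive_gram.
  apply: (@deriveB _ _ _ (fun z : GX R S => z.2 a b) (fun z => gram z a b)).
    by apply: diff_derivable; case: (C1_coord2 R a b).
  by apply: diff_derivable; case: (C1_gram R a b).
have [[dphi _] _] := (C1cE phi).1 Cphi; have [dih _] := Ch.
have h0 z : G z -> h z = 0 by move=> Gz; rewrite /h gram_G// subrr.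
(* As [h] vanishes on [G], only [phi] times a derivative of [h] survives. It is 0 in the [x]
   directions, and in the direction [B_i] it is the entry [ab] of [B_i] minus that of its
   symmetrization. *)
have E z : G z -> curv_integrand (fun z => phi z * h z) B i z =
    B z i a b * phi z - sym_curv z i a b * phi z.
  move=> Gz; rewrite /curv_integrand contract; last by exact: (@differentiableM _ _ phi h).
  rewrite deriveM_fun// h0// mul0r addr0 dh /= [curv_mx z i a b]mxE.
  rewrite [X in X + _ + _]big1 ?add0r => [|j _]; last first.
    rewrite /Dx deriveM_fun// h0// mul0r addr0 dh /=.
    by rewrite gram_derivE big1 ?mxE ?subrr ?mulr0// => k _; rewrite !mxE mul0r mulr0 addr0.
  rewrite big1 ?addr0 => [|j _]; last by rewrite mulr0 mulr0.
  by rewrite /sym_curv; ring.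
have iB : integrable_on (fun z => B z i a b * phi z).
  by apply: integrable_onM => //; apply: continuous_subspaceT; exact: C1_continuous ((C1cE phi).1 Cphi).1.
have iS : integrable_on (fun z => sym_curv z i a b * phi z).
  apply: integrable_onM; first exact: integrable_sym_curv.
  by apply: continuous_subspaceT; exact: C1_continuous ((C1cE phi).1 Cphi).1.
have EI : I (curv_integrand (fun z => phi z * h z) B i) =
    I (fun z => B z i a b * phi z - sym_curv z i a b * phi z).
  by apply: eq_Rintegral => z; rewrite inE => /E.
have := test i (C1cM Cphi Ch); rewrite EI RintegralB//.
by move=> /eqP; rewrite subr_eq0 => /eqP.
Qed.

(* Test with [phi (x, P P^T)]. *)
Lemma curv_test_gram (phi : GX R S -> R) (i : 'I_S) : C1c phi ->
  I (fun z : GX R S => (\sum_j z.2 i j * Dx j phi z) +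
    (\sum_j \sum_k sym_curv z i j k * DP j k phi z) + (\sum_j B z j i j * phi z)) = 0.
Proof.
move=> Cphi; rewrite -[RHS](test i (C1c_comp_gram_map Cphi)); apply: eq_Rintegral => z.
rewrite inE => Gz; have [[dphi _] _] := (C1cE phi).1 Cphi.
have Tz : gram_map z = z by rewrite /gram_map gram_G//; case: (z).
have [[dT _] _] := (C1cE _).1 (C1c_comp_gram_map Cphi).
rewrite /curv_integrand contract//.
have DT v : 'D_v (phi \o @gram_map R S) z = 'D_((v.1, gram_deriv z v.2) : GX R S) phi z.
  by rewrite derive_comp_gram_map ?Tz.
have g0 : gram_deriv z 0 = 0 by rewrite /gram_deriv mul0mx trmx0 mulmx0 addr0.
congr (_ + _ + _).
- by apply: eq_bigr => j _; rewrite /Dx DT /= g0.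
- by rewrite DT derive_split// derive0 add0r.
- by apply: eq_bigr => j _; rewrite /= Tz.
Qed.

(** After the substitution of [P P^T] the zeroth-order term still contains [B];
    [curv_symmetrization] exchanges it. Equality of integrals is enough, so no almost everywhere
    identity between [B] and [sym_curv] has to be extracted. *)
Lemma curv_sym_test phi i : C1c phi -> I (curv_integrand phi sym_curv i) = 0.
Proof.
move=> Cphi; have [[dphi cD] _] := (C1cE phi).1 Cphi.
have cphi : continuous phi by exact: C1_continuous ((C1cE phi).1 Cphi).1.
have wphi : {within G, continuous phi} by exact: continuous_subspaceT.
pose X (z : GX R S) : R := (\sum_j z.2 i j * Dx j phi z) +
    (\sum_j \sum_k sym_curv z i j k * DP j k phi z).
have iX : integrable_on X.
  have wD v : {within G, continuous ('D_v phi)} by exact: continuous_subspaceT.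
  apply: integrableD_fun => //.
    apply: integrable_fsum => // j; apply: within_integrable_on.
    by move=> z; apply: cvgM; [exact: coord2_within|exact: wD].
  apply: integrable_fsum => // j; apply: integrable_fsum => // k.
  by apply: integrable_onM; [exact: integrable_sym_curv|exact: wD].
have iBp j : integrable_on (fun z => B z j i j * phi z) by exact: integrable_onM.
have iSp j : integrable_on (fun z => sym_curv z j i j * phi z).
  by apply: integrable_onM => //; exact: integrable_sym_curv.
have iSB : integrable_on (fun z => \sum_j B z j i j * phi z) by exact: integrable_fsum.
have iSS : integrable_on (fun z => \sum_j sym_curv z j i j * phi z) by exact: integrable_fsum.
rewrite -[RHS](curv_test_gram i Cphi) (RintegralD mG iX iSB) (RintegralD mG iX iSS).
congr (_ + _); rewrite (Rintegral_fsum mG iSp) (Rintegral_fsum mG iBp).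
by apply: eq_bigr => j _; rewrite (curv_symmetrization _ _ _ Cphi).
Qed.

End CurvatureIdentity.

(** * The second fundamental form *)

(** The integral of a nonnegative function is a supremum over simple functions below it, so it is
    monotone without measurability. This spares a proof that [F z (sff Q B z)] is measurable in
    [z]. *)
Lemma ge0_le_integral_nonmeasurable (d : measure_display) (T : measurableType d)
    (R : realType) (mu : {measure set T -> \bar R}) (D : set T) (f g : T -> \bar R) :
  (forall x, D x -> (0 <= f x)%E) -> (forall x, D x -> (f x <= g x)%E) ->
  (\int[mu]_(x in D) f x <= \int[mu]_(x in D) g x)%E.
Proof.
move=> f0 fg; have g0 x : D x -> (0 <= g x)%E by move=> Dx; exact: le_trans (f0 x Dx) (fg x Dx).
rewrite !ge0_integralE//; apply: le_ereal_sup => _ [h hf <-]; exists h => // x.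
apply: le_trans (hf x) _; rewrite /patch; case: ifPn => // Dx.
by apply: fg; rewrite -in_setE.
Qed.

(** On the sphere [|q| = e] over the compact [G] the function has a positive minimum [d0]. As [F]
    vanishes at [q = 0], convexity along rays makes it grow at least with slope [d0 / e] beyond the
    sphere. *)
Lemma condF_lower_bound (R : realType) (S : nat) (G : set (GX R S)) (F : GX R S -> T3 R S -> R) (e : R) :
  compact G -> condF G F -> 0 < e ->
  exists2 d : R, 0 < d & forall z q, G z -> d * (`|q| - e) <= F z q.
Proof.
move=> cG [cF F0 Fconv _] e0.
pose A : set (GX R S * T3 R S) := G `*` [set q | `|q| = e].
have cA : compact A.
  apply: compact_setX => //.
  apply: (@subclosed_compact _ _ [set q : 'M[R]_(S, S * S) | `|q| <= e]).
  - apply: (@closed_comp _ _ (fun q : 'M[R]_(S, S * S) => `|q|) [set x | x = e]); last exact: closed_eq.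
    by move=> x _; exact: norm_continuous.
  - exact: mx_ball_compact.
  - by move=> q /= ->.
have [d0 d00 d0P] : exists2 d : R, 0 < d & forall z q, G z -> `|q| = e -> d <= F z q.
  (* The sphere bundle is empty when [G] is empty or [S = 0]; any positive constant then serves. *)
  have [A0|/set0P A0] := eqVneq A set0.
    exists 1 => // z q Gz qe; exfalso.
    by have : A (z, q) by []; rewrite A0.
  have wA : {within A, continuous (fun p : GX R S * T3 R S => F p.1 p.2)}.
    by apply: continuous_subspaceW cF => -[z q] [].
  have [[z q]] := compact_EVT_min A0 cA wA; rewrite inE => -[/= Gz qe] zqP.
  exists (F z q) => [|z' q' Gz' qe']; last first.
    by apply: (zqP (z', q')); rewrite inE.
  rewrite lt_neqAle (F0 z q Gz).1 andbT eq_sym; apply/eqP => /(F0 z q Gz).2 q0.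
  by move: qe; rewrite q0 /= normr0 => /esym/eqP; rewrite gt_eqF.
exists (d0 / e); first by rewrite divr_gt0.
move=> z q Gz; have [qe|qe] := leP `|q| e.
  by rewrite (le_trans _ (F0 z q Gz).1)// mulr_ge0_le0 ?subr_le0// ltW// divr_gt0.
have q0 : 0 < `|q| by exact: lt_trans qe.
pose t := e / `|q|.
have t0 : 0 < t by rewrite divr_gt0.
have t1 : t <= 1 by rewrite ler_pdivrMr// mul1r ltW.
have := Fconv z q 0 t Gz (ltW t0) t1.
rewrite scaler0 addr0 ((F0 z 0 Gz).2.2 erefl) mulr0 addr0 => Ft.
have := d0P z (t *: q) Gz; rewrite normrZ gtr0_norm// /t divfK ?gt_eqF// => /(_ erefl).
move=> /le_trans/(_ Ft); rewrite /t => h.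
have : d0 / e * `|q| <= F z q.
  have := ler_wpM2l (ltW (divr_gt0 q0 e0)) h.
  have -> : `|q| / e * (e / `|q| * F z q) = F z q by field; rewrite !gt_eqF.
  by have -> : d0 / e * `|q| = `|q| / e * d0 by ring.
by apply: le_trans; apply: ler_wpM2l; [rewrite ltW// divr_gt0|rewrite gerBl ltW].
Qed.

(** * The curvature with null second fundamental form *)

Section LimitCurvature.
Variables (R : realType) (S n m : nat) (M N : set 'rV[R]_S) (Q : 'rV[R]_S -> 'M[R]_S).
Hypothesis embM : embedded_submanifold n M.
Hypothesis NM : N `<=` M.
Hypothesis projQ : forall x, M x -> orth_proj_onto (Q x) (tangent M x).
Hypothesis diffQ : forall x, M x -> differentiable (Q : RV R S -> 'M[R]_S) x.

Local Notation G := (Gm M N m).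

(** This is [A^k_ij], with the indices in the order of [proj_deriv z i k j]. *)
Definition sff_entry (B : GX R S -> 'I_S -> 'I_S -> 'I_S -> R) (i k j : 'I_S) (z : GX R S) : R :=
  sff Q B z k (mxvec_index i j).

Lemma sff_entryE B i k j z : G z ->
  sff_entry B i k j z = (\sum_l z.2 l j * B z i k l) - proj_deriv Q z i k j.
Proof.
move=> Gz; rewrite /sff_entry mxE mxvecE mxE; congr (_ - _).
exact: (proj_derivE NM diffQ i k j Gz).
Qed.

Lemma sff_entry_le B i k j z : `|sff_entry B i k j z| <= `|sff Q B z|.
Proof. exact: mx_coord_le. Qed.

(* The curvature determined by [A = 0]: [c_ijk = K_ijk + K_ikj] with [K = proj_deriv]. *)
Definition flat_curv (z : GX R S) i j k : R := proj_deriv Q z i j k + proj_deriv Q z i k j.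

(** Contracting the last index with [P] keeps [K_i], since [K_i P = K_i], and kills its transpose,
    since [P K_i = 0]; what is left is cancelled by the correction term in [A]. *)
Lemma sff_flat_curv z : G z -> sff Q flat_curv z = 0.
Proof.
move=> Gz; apply/matrixP => k a; case/mxvec_indexP: a => i j; rewrite [RHS]mxE.
rewrite -[LHS]/(sff_entry flat_curv i k j z) sff_entryE//.
have zt a b : z.2 a b = z.2 b a by rewrite -{1}(Gm_tr Gz) mxE.
have KP : proj_deriv Q z i *m z.2 = proj_deriv Q z i.
  by rewrite /proj_deriv -mulmxA (Gm_idem Gz).
have PK := mul_proj_deriv NM projQ diffQ i Gz.
have -> : \sum_l z.2 l j * flat_curv z i k l =
    (proj_deriv Q z i *m z.2) k j + (z.2 *m proj_deriv Q z i) j k.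
  rewrite [X in _ = X + _]mxE [X in _ = _ + X]mxE -big_split/=; apply: eq_bigr => l _.
  by rewrite /flat_curv mulrDr [z.2 j l]zt; congr (_ + _); rewrite mulrC.
by rewrite PK KP [X in _ + X - _]mxE addr0 subrr.
Qed.

Lemma flat_curv_within i j k : {within G, continuous (fun z => flat_curv z i j k)}.
Proof.
have H a b := @proj_deriv_continuous R S n m M N Q embM NM projQ diffQ i a b.
by move=> z; apply: cvgD; exact: H.
Qed.

(** The definition of [A] says that [B_i P] has entries [A^k_ij + K_ikj]; adding the transpose gives
    the decomposition. *)
Lemma sym_curv_decomp B i j k z : G z ->
  sym_curv B z i j k = flat_curv z i j k + (sff_entry B i j k z + sff_entry B i k j z).
Proof.
move=> Gz; rewrite !sff_entryE// /sym_curv gram_derivE /flat_curv.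
have zt a b : z.2 a b = z.2 b a by rewrite -{1}(Gm_tr Gz) mxE.
rewrite big_split/=.
have -> : \sum_l curv_mx B z i j l * z.2 k l = \sum_l z.2 l k * B z i j l.
  by apply: eq_bigr => l _; rewrite mxE zt mulrC.
have -> : \sum_l z.2 j l * curv_mx B z i k l = \sum_l z.2 l j * B z i k l.
  by apply: eq_bigr => l _; rewrite mxE zt.
ring.
Qed.

End LimitCurvature.

(** * Limits of almost flat varifolds *)

Section EnergyBound.
Variables (R : realType) (S n m : nat) (M N : set 'rV[R]_S) (Q : 'rV[R]_S -> 'M[R]_S).
Hypothesis embM : embedded_submanifold n M.
Hypothesis NM : N `<=` M.
Hypothesis compactN : compact (N : set (RV R S)).
Hypothesis projQ : forall x, M x -> orth_proj_onto (Q x) (tangent M x).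
Hypothesis diffQ : forall x, M x -> differentiable (Q : RV R S -> 'M[R]_S) x.

Local Notation G := (Gm M N m).
Local Notation BG := (G : set (GXm R S)).

Let clG : closed G := Gm_closed (m := m) NM compactN projQ diffQ.
Let cptG : compact G := Gm_compact (m := m) NM compactN projQ diffQ.
Let mG : measurable BG := borel_closed clG.

Let projG (z : GX R S) : G z -> z.2^T = z.2 /\ z.2 *m z.2 = z.2.
Proof. by move=> Gz; split; [exact: Gm_tr Gz|exact: Gm_idem Gz]. Qed.

Lemma sff_entry_integrable (V : {measure set GXm R S -> \bar R}) B i k j :
  (V setT < +oo)%E -> gen_curvature G V B -> integrable_on G V (sff_entry Q B i k j).
Proof.
move=> Vfin [intB _].
have : integrable_on G V (fun z => (\sum_l B z i k l * z.2 l j) - proj_deriv Q z i k j).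
  apply: integrableD_fun => //.
    apply: integrable_fsum => // l; apply: integrable_onM => //; first exact: intB.
    exact: coord2_within.
  apply: integrableN_fun => //; apply: within_integrable_on => //.
  exact: proj_deriv_continuous embM NM projQ diffQ i k j.
apply: eq_integrable => // z; rewrite inE => Gz /=.
rewrite (sff_entryE NM diffQ _ _ _ _ Gz); congr ((_ - _)%:E).
by apply: eq_bigr => l _; rewrite mulrC.
Qed.

(** Pointwise [|a|] is at most [e] plus the positive part of [|a| - e], and [d] times that positive
    part is at most [F]. *)
Lemma sff_entry_energy (F : GX R S -> T3 R S -> R) (V : {measure set GXm R S -> \bar R}) B
    i k j (e d E : R) :
  (V setT < +oo)%E -> gen_curvature G V B -> 0 < e -> 0 < d ->
  (forall z q, G z -> 0 <= F z q) ->
  (forall z q, G z -> d * (`|q| - e) <= F z q) ->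
  (\int[V]_(z in BG) (F z (sff Q B z))%:E <= E%:E)%E ->
  \int[V]_(z in BG) `|sff_entry Q B i k j z| <= e * fine (V BG) + E / d.
Proof.
move=> Vfin curvB e0 d0 F0 dF FE.
have ia := sff_entry_integrable i k j Vfin curvB.
have iabs : integrable_on G V (fun z => `|sff_entry Q B i k j z|).
  by have := integrable_abse ia; apply: eq_integrable => // z _; rewrite /= abse_EFin.
have ma : measurable_fun BG (sff_entry Q B i k j : GXm R S -> R).
  by have /measurable_int/measurable_EFinP := ia.
pose g (z : GX R S) : R := Num.max 0 (`|sff_entry Q B i k j z| - e).
have g0 z : 0 <= g z by rewrite le_max lexx.
have mg : measurable_fun BG (g : GXm R S -> R).
  apply: measurable_maxr; first exact: measurable_cst.
  by apply: measurable_funB; [exact: measurableT_comp|exact: measurable_cst].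
have ig : integrable_on G V g.
  apply: le_integrable iabs => //; first exact/measurable_EFinP.
  move=> z _ /=; rewrite lee_fin ger0_norm// ger0_norm// ge_max normr_ge0/=.
  by rewrite gerBl ltW.
have ie : integrable_on G V (fun=> e).
  by apply: within_integrable_on => // z; exact: cvg_cst.
have dgE : d * \int[V]_(z in BG) g z <= E.
  rewrite -RintegralZl// -lee_fin fineK; last first.
    by apply: integrable_fin_num => //; have := integrableZl mG d ig; apply: eq_integrable.
  apply: le_trans FE; apply: ge0_le_integral_nonmeasurable => z Gz; rewrite lee_fin.
    by rewrite mulr_ge0// ltW.
  rewrite /g; have [h|h] := leP 0 (`|sff_entry Q B i k j z| - e); last by rewrite mulr0 F0.
  apply: le_trans (dF z _ Gz); apply: ler_wpM2l; first exact: ltW.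
  by rewrite lerD2r; exact: sff_entry_le.
apply: (@le_trans _ _ (\int[V]_(z in BG) (e + g z))).
  apply: le_Rintegral => //; first by apply: integrableD_fun.
  by move=> z _; rewrite -lerBlDl le_max lexx orbT.
rewrite RintegralD// Rintegral_cst// lerD2l.
by rewrite ler_pdivlMr// mulrC.
Qed.

(** * Passage to the limit when A tends to zero in the mean *)

Section FlatLimit.
Variables (V : nat -> {measure set GXm R S -> \bar R}).
Variable B : nat -> GX R S -> 'I_S -> 'I_S -> 'I_S -> R.
Hypothesis finV : forall r, (V r setT < +oo)%E.
Hypothesis massV : forall r, (0 < V r BG < +oo)%E.
Hypothesis curvB : forall r, gen_curvature G (V r) (B r).
Hypothesis sff0 : forall i k j,
  (fun r => \int[V r]_(z in BG) `|sff_entry Q (B r) i k j z| / fine (V r BG)) @ \oo --> (0 : R).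

Let avg (r : nat) (f : GX R S -> R) : R := \int[V r]_(z in BG) f z / fine (V r BG).

Let mass0 r : 0 < fine (V r BG).
Proof. by rewrite fine_gt0. Qed.

(** The integrands vary with [r], as does the curvature. Integrability is carried along because
    additivity of the real-valued integral requires it. *)
Definition null_average (u : nat -> GX R S -> R) : Prop :=
  (forall r, integrable_on G (V r) (u r)) /\ (fun r => avg r (u r)) @ \oo --> (0 : R).

Lemma null_averageD u v : null_average u -> null_average v ->
  null_average (fun r z => u r z + v r z).
Proof.
move=> [iu u0] [iv v0]; split => [r|].
  by apply: integrableD_fun => //; [exact: iu|exact: iv].
rewrite (_ : (fun r => _) = fun r => avg r (u r) + avg r (v r)).
  by rewrite -[0]addr0; exact: cvgD.
by apply/funext => r; rewrite /avg (RintegralD mG (iu r) (iv r)) mulrDl.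
Qed.

Lemma null_average_sum p (u : 'I_p -> nat -> GX R S -> R) :
  (forall l, null_average (u l)) -> null_average (fun r z => \sum_l u l r z).
Proof.
move=> u0; have iu r l : integrable_on G (V r) (u l r) by case: (u0 l).
split => [r|]; first by apply: integrable_fsum => // l; exact: iu.
rewrite (_ : (fun r => _) = fun r => \sum_l avg r (u l r)).
  have FF : Filter (\oo : set_system nat) by exact: eventually_filter.
  have := @cvg_fsum R nat \oo FF 'I_p (index_enum 'I_p) xpredT (fun l r => avg r (u l r))
    (fun=> 0) (fun l _ => (u0 l).2).
  by rewrite big1//; exact.
by apply/funext => r; rewrite /avg (Rintegral_fsum mG (iu r)) mulr_suml.
Qed.

Lemma null_averageM i k j (g : GX R S -> R) : {within G, continuous g} ->
  null_average (fun r z => sff_entry Q (B r) i k j z * g z).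
Proof.
move=> cg.
have ia r : integrable_on G (V r) (sff_entry Q (B r) i k j) by exact: sff_entry_integrable.
have iag r : integrable_on G (V r) (fun z => sff_entry Q (B r) i k j z * g z).
  exact: integrable_onM.
have iabs r : integrable_on G (V r) (fun z => `|sff_entry Q (B r) i k j z|).
  by have := integrable_abse (ia r); apply: eq_integrable => // z _; rewrite /= abse_EFin.
split => //; have [K [K0 gK]] := within_bounded cptG cg.
apply: norm_cvg0.
have lim0 : (fun r => K * (\int[V r]_(z in BG) `|sff_entry Q (B r) i k j z| / fine (V r BG)))
    @ \oo --> (0 : R).
  by rewrite -[0](mulr0 K); apply: cvgM; [exact: cvg_cst|exact: sff0].
apply: (squeeze_cvgr _ (cvg_cst 0) lim0); near=> r; rewrite normr_ge0/=.
rewrite /avg normrM [X in _ * X]gtr0_norm ?invr_gt0// mulrA ler_pM2r ?invr_gt0//.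
apply: le_trans (le_normr_Rintegral mG (iag r)) _; rewrite -(RintegralZl K mG (iabs r)).
apply: le_Rintegral => //.
- by have := integrable_abse (iag r); apply: eq_integrable => // z _; rewrite /= abse_EFin.
- by have := integrableZl mG K (iabs r); apply: eq_integrable.
- by move=> z Gz; rewrite normrM mulrC ler_wpM2r// gK.
Unshelve. all: by end_near. Qed.

(** With [sym_curv] in place of [flat_curv] every average is exactly 0. The difference [rest] is
    linear in the entries of [A] with coefficients continuous on [G], hence has averages tending to
    0. *)
Lemma flat_average phi i : C1c phi ->
  (fun r => avg r (curv_integrand phi (flat_curv Q) i)) @ \oo --> (0 : R).
Proof.
move=> Cphi; have [[dphi cD] _] := (C1cE phi).1 Cphi.
have cphi : {within G, continuous phi}.
  by apply: continuous_subspaceT; exact: C1_continuous ((C1cE phi).1 Cphi).1.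
have wD v : {within G, continuous ('D_v phi)} by exact: continuous_subspaceT.
pose rest r (z : GX R S) : R :=
  (\sum_j \sum_k (sff_entry Q (B r) i j k z * DP j k phi z + sff_entry Q (B r) i k j z * DP j k phi z))
  + (\sum_j (sff_entry Q (B r) j i j z * phi z + sff_entry Q (B r) j j i z * phi z)).
have [irest rest0] : null_average rest.
  apply: null_averageD; apply: null_average_sum => j; last by apply: null_averageD; exact: null_averageM.
  by apply: null_average_sum => k; apply: null_averageD; apply: null_averageM; exact: wD.
have iflat r : integrable_on G (V r) (curv_integrand phi (flat_curv Q) i).
  apply: integrable_curv => // a b c; apply: within_integrable_on => //.
  exact: flat_curv_within embM NM projQ diffQ a b c.
rewrite (_ : (fun r => _) = fun r => - avg r (rest r)).
  by rewrite -oppr0; exact: cvgN.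
apply/funext => r; apply/eqP; rewrite -addr_eq0 /avg -mulrDl -(RintegralD mG (iflat r) (irest r)).
rewrite -[X in X / _](_ : \int[V r]_(z in BG) curv_integrand phi (sym_curv (B r)) i z = _).
  by rewrite (curv_sym_test clG cptG projG (finV r) (curvB r))// mul0r.
apply: eq_Rintegral => z; rewrite inE => Gz.
rewrite /curv_integrand /rest.
have -> : \sum_j \sum_k sym_curv (B r) z i j k * DP j k phi z =
    \sum_j \sum_k flat_curv Q z i j k * DP j k phi z +
    \sum_j \sum_k (sff_entry Q (B r) i j k z * DP j k phi z +
      sff_entry Q (B r) i k j z * DP j k phi z).
  rewrite -big_split/=; apply: eq_bigr => j _; rewrite -big_split/=; apply: eq_bigr => k _.
  by rewrite (sym_curv_decomp NM diffQ _ _ _ _ Gz); ring.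
have -> : \sum_j sym_curv (B r) z j i j * phi z = \sum_j flat_curv Q z j i j * phi z +
    \sum_j (sff_entry Q (B r) j i j z * phi z + sff_entry Q (B r) j j i z * phi z).
  rewrite -big_split/=; apply: eq_bigr => j _.
  by rewrite (sym_curv_decomp NM diffQ _ _ _ _ Gz); ring.
ring.
Qed.

Lemma flat_limit : exists W : {measure set GXm R S -> \bar R},
  [/\ varifold G W, gen_curvature G W (flat_curv Q) & W BG = 1%E].
Proof.
have [W [W1 W0 Wlim]] := measures_weakly_compact clG cptG massV.
exists W; split.
- by split => //; rewrite W1 ltry.
- have Wfin : (W setT < +oo)%E by rewrite W1 ltry.
  have iflat i j k : integrable_on G W (fun z => flat_curv Q z i j k).
    by apply: within_integrable_on => //; exact: flat_curv_within embM NM projQ diffQ i j k.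
  split => // phi Cphi i.
  have ic : integrable_on G W (curv_integrand phi (flat_curv Q) i) by exact: integrable_curv.
  have wc : {within G, continuous (curv_integrand phi (flat_curv Q) i)}.
    have [[dphi cD] _] := (C1cE phi).1 Cphi.
    have cphi : {within G, continuous phi}.
      by apply: continuous_subspaceT; exact: C1_continuous ((C1cE phi).1 Cphi).1.
    have wD v : {within G, continuous ('D_v phi)} by exact: continuous_subspaceT.
    have wf a b c := @flat_curv_within R S n m M N Q embM NM projQ diffQ a b c.
    move=> z; apply: cvgD; [apply: cvgD|]; apply: cvg_fsum => j _.
    + by apply: cvgM; [exact: coord2_within|exact: wD].
    + by apply: cvg_fsum => k _; apply: cvgM; [exact: wf|exact: wD].
    + by apply: cvgM; [exact: wf|exact: cphi].
  have fn := integrable_fin_num mG ic.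
  by rewrite -[LHS](fineK fn) -[fine _]/(Rintegral _ _ _) (Wlim _ _ wc (flat_average i Cphi)).
- have : W setT = (W BG + W (~` BG))%E.
    rewrite -measureU ?setUv ?setICr//; exact: measurableC.
  by rewrite W1 W0 adde0.
Qed.

End FlatLimit.

End EnergyBound.

(** * The equivalence *)

(** Without measurability of [f], comparison is made with the measurable function equal to [+oo] on
    a null set and to 0 elsewhere. *)
Lemma integral_ae_zero_ge0 (d : measure_display) (T : measurableType d) (R : realType)
    (mu : {measure set T -> \bar R}) (D : set T) (f : T -> \bar R) :
  measurable D -> (forall x, D x -> (0 <= f x)%E) -> {ae mu, forall x, D x -> f x = 0%E} ->
  (\int[mu]_(x in D) f x = 0)%E.
Proof.
move=> mD f0 [A [mA A0 fA]].
apply/eqP; rewrite eq_le integral_ge0// andbT.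
pose g (x : T) : \bar R := if x \in A then +oo%E else 0%E.
have g0 x : (0 <= g x)%E by rewrite /g; case: ifP.
have mg : measurable_fun setT g.
  by apply: measurable_fun_ifT => //; apply: (@measurable_fun_bool _ _ _ _ true);
    rewrite setTI (_ : _ @^-1` _ = A)//; apply/seteqP; split => [x /set_mem//|x /mem_set].
have fg x : D x -> (f x <= g x)%E.
  rewrite /g => Dx; case: ifPn => [_|xA]; first exact: leey.
  have [->//|fx] := pselect (f x = 0%E).
  move: xA; rewrite notin_setE => xA; exfalso; apply: xA; apply: fA => /= h.
  exact: fx (h Dx).
apply: (@le_trans _ _ (\int[mu]_(x in D) g x)%E).
  exact: ge0_le_integral_nonmeasurable.
rewrite (ge0_negligible_integral mA mD (measurable_funTS mg))//.
by rewrite integral0_eq// => x [_ nA]; rewrite /g memNset.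
Qed.

Lemma normr_sqr_condF (R : realType) (S : nat) (G : set (GX R S)) :
  condF G (fun _ (q : T3 R S) => `|q| ^+ 2).
Proof.
split.
- apply: continuous_subspaceT => p.
  have cn : (fun p : GX R S * T3 R S => `|p.2|) @ nbhs p --> `|p.2|.
    by apply: cvg_norm; exact: cvg_snd.
  exact: (cvgM cn cn).
- move=> z q _; split; first exact: sqr_ge0.
  by split => [/eqP|->]; rewrite ?normr0 ?expr0n//= sqrf_eq0 normr_eq0 => /eqP.
- move=> z q1 q2 t _ t0 t1.
  have t1' : 0 <= 1 - t by rewrite subr_ge0.
  have h : `|t *: q1 + (1 - t) *: q2| <= t * `|q1| + (1 - t) * `|q2|.
    by rewrite (le_trans (ler_normD _ _))// !normrZ !ger0_norm.
  apply: (@le_trans _ _ ((t * `|q1| + (1 - t) * `|q2|) ^+ 2)).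
    by rewrite ler_pXn2r ?nnegrE// addr_ge0// mulr_ge0.
  (* The convexity defect of the square is [t (1 - t)] times the square of the difference of the
     norms. *)
  rewrite -subr_ge0.
  have -> : t * `|q1| ^+ 2 + (1 - t) * `|q2| ^+ 2 - (t * `|q1| + (1 - t) * `|q2|) ^+ 2 =
    t * (1 - t) * (`|q1| - `|q2|) ^+ 2 by ring.
  by apply: mulr_ge0; [exact: mulr_ge0|exact: sqr_ge0].
- exists (fun _ t => t); split => //.
  + by apply: continuous_subspaceT => p; exact: cvg_snd.
  + move=> z0 _; exists setT; split; first exact: filterT.
    by move=> K; exists K.
Qed.

Section MassEnergy.
Variables (R : realType) (S n m : nat) (M N : set 'rV[R]_S) (Q : 'rV[R]_S -> 'M[R]_S).
Hypothesis embM : embedded_submanifold n M.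
Hypothesis NM : N `<=` M.
Hypothesis compactN : compact (N : set (RV R S)).
Hypothesis projQ : forall x, M x -> orth_proj_onto (Q x) (tangent M x).
Hypothesis diffQ : forall x, M x -> differentiable (Q : RV R S -> 'M[R]_S) x.

Local Notation G := (Gm M N m).
Local Notation BG := (G : set (GXm R S)).
Local Notation energy F V B := (\int[V]_(z in BG) (F z (sff Q B z))%:E)%E.

Let mG : measurable BG := borel_closed (Gm_closed (m := m) NM compactN projQ diffQ).

Lemma mass_le_energy (F : GX R S -> T3 R S -> R) :
  (forall (V : {measure set GXm R S -> \bar R}) B, varifold G V -> gen_curvature G V B ->
    {ae V, forall z : GXm R S, G z -> sff Q B z = 0} -> V BG = 0%E) ->
  condF G F ->
  exists CF : R, 0 < CF /\
    forall (V : {measure set GXm R S -> \bar R}) B, varifold G V -> gen_curvature G V B ->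
    (V BG <= CF%:E * energy F V B)%E.
Proof.
move=> rigid HF; apply: contrapT => noC.
have : forall r : nat, exists p : {measure set GXm R S -> \bar R} *
    (GX R S -> 'I_S -> 'I_S -> 'I_S -> R),
  [/\ varifold G p.1, gen_curvature G p.1 p.2 &
    (r.+1%:R%:E * energy F p.1 p.2 < p.1 BG)%E].
  (* The candidate constant must be positive, hence [r.+1]. *)
  move=> r; apply: contrapT => nop; apply: noC; exists r.+1%:R; split => // V B vV cV.
  by rewrite leNgt; apply/negP => lt; apply: nop; exists (V, B).
move=> /choice[p pP].
pose V r := (p r).1; pose B r := (p r).2.
have F0 z q : G z -> 0 <= F z q by case: HF => _ h _ _ Gz; case: (h z q Gz).
have E0 r : (0 <= energy F (V r) (B r))%E.
  by apply: integral_ge0 => z Gz; rewrite lee_fin F0.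
have finV r : (V r setT < +oo)%E by case: (pP r) => -[].
(* The mass strictly exceeds a nonnegative multiple of the energy, so it is positive and the
   measures can be normalized. *)
have massV r : (0 < V r BG < +oo)%E.
  apply/andP; split; first by case: (pP r) => _ _; apply: le_lt_trans; apply: mule_ge0 => //; exact: E0.
  by apply: le_lt_trans (finV r); apply: le_measure; rewrite ?inE.
have m0 r : 0 < fine (V r BG) by rewrite fine_gt0.
have finm r : V r BG \is a fin_num by have /andP[_ h] := massV r; rewrite ge0_fin_numE.
have curvB r : gen_curvature G (V r) (B r) by case: (pP r).
have EV r : (energy F (V r) (B r) <= (fine (V r BG) / r.+1%:R)%:E)%E.
  case: (pP r) => _ _ /ltW; rewrite -/(V r) -/(B r) => h.
  by rewrite EFinM fineK// muleC lee_pdivlMl ?ltr0n.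
have sff0 i k j : (fun r => \int[V r]_(z in BG) `|sff_entry Q (B r) i k j z| /
    fine (V r BG)) @ \oo --> (0 : R).
  apply/cvgrPdist_le => eps eps0.
  (* Half of [eps] is the threshold below which [A] is not controlled; the other half bounds the
     energy term [1 / (r.+1 d)] for large [r]. *)
  have e20 : 0 < eps / 2 by rewrite divr_gt0.
  have [d d0 dF] := condF_lower_bound (Gm_compact (m := m) NM compactN projQ diffQ) HF e20.
  near=> r.
  rewrite sub0r normrN ger0_norm; last first.
    by rewrite divr_ge0 ?Rintegral_ge0// ltW.
  rewrite ler_pdivrMr//.
  have := sff_entry_energy embM NM compactN projQ diffQ i k j (finV r) (curvB r) e20 d0 F0 dF (EV r).
  move/le_trans; apply.
  have re : (eps / 2 * d)^-1 <= r.+1%:R.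
    apply: (@le_trans _ _ r%:R); last by rewrite ler_nat.
    near: r; exact: nbhs_infty_ger.
  have rd : r.+1%:R^-1 / d <= eps / 2.
    by rewrite ler_pdivrMr// -[leRHS]invrK lef_pV2 ?posrE ?invr_gt0 ?mulr_gt0.
  rewrite [leRHS](_ : _ = eps / 2 * fine (V r BG) + fine (V r BG) * (eps / 2)); last by field.
  by rewrite lerD2l -mulrA ler_wpM2l// ltW.
have [W [vW cW W1]] := flat_limit embM NM compactN projQ diffQ finV massV curvB sff0.
have := rigid W (flat_curv Q) vW cW.
rewrite W1 => /(_ _)/eqP; rewrite onee_eq0 => H; suff : false by [].
apply: H; apply: aeW => z Gz; exact: sff_flat_curv NM projQ diffQ z Gz.
Unshelve. all: by end_near. Qed.

End MassEnergy.

Unset Implicit Arguments.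

(** In (ii) finite energy is required because [Phi] takes real arguments; in (iii) the product is
    taken in the extended reals and covers infinite energy. Nullity of [A] in (i) is understood
    almost everywhere, in accordance with [B] being an integrable function. *)
Theorem theorem4p1 (R : realType) (S n m : nat)
  (Nbar N : set 'rV[R]_S) (Q : 'rV[R]_S -> 'M[R]_S) :
  embedded_submanifold n Nbar ->
  N `<=` Nbar -> compact (N : set (RV R S)) ->
  (1 <= m)%N -> (m <= n - 1)%N ->
  (forall x, Nbar x -> orth_proj_onto (Q x) (tangent Nbar x)) ->
  (forall x, Nbar x -> differentiable (Q : RV R S -> 'M[R]_S) x) ->
  let G : set (GX R S) := Gm Nbar N m in
  let mass (V : {measure set GXm R S -> \bar R}) := V (G : set (GXm R S)) in
  let energy (F : GX R S -> T3 R S -> R) (V : {measure set GXm R S -> \bar R})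
      (B : GX R S -> 'I_S -> 'I_S -> 'I_S -> R) :=
    (\int[V]_(z in (G : set (GXm R S))) (F z (sff Q B z))%:E)%E in
  let cond_i :=
    forall V B, varifold G V -> gen_curvature G V B ->
      {ae V, forall z : GXm R S, G z -> sff Q B z = 0} ->
      mass V = 0%E in
  (cond_i <->
    exists Phi : R -> R,
      [/\ (forall s t, 0 <= s -> s <= t -> Phi s <= Phi t), Phi 0 = 0,
          (forall t, 0 <= t -> 0 <= Phi t) &
          exists F, condF G F /\
            forall V B, varifold G V -> gen_curvature G V B ->
              (energy F V B < +oo)%E ->
              (mass V <= (Phi (fine (energy F V B)))%:E)%E]) /\
  (cond_i <->
    forall F, condF G F ->
      exists CF : R, 0 < CF /\
        forall V B, varifold G V -> gen_curvature G V B ->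
          (mass V <= CF%:E * energy F V B)%E).
Proof.
move=> embM NM compactN _ _ projQ diffQ G mass energy cond_i.
have mG : measurable (G : set (GXm R S)).
  exact: borel_closed (Gm_closed (m := m) NM compactN projQ diffQ).
have i_iii : cond_i -> forall F, condF G F -> exists CF : R, 0 < CF /\
    forall V B, varifold G V -> gen_curvature G V B -> (mass V <= CF%:E * energy F V B)%E.
  by move=> ci F HF; exact: (mass_le_energy embM NM compactN projQ diffQ ci HF).
have iii_ii : (forall F, condF G F -> exists CF : R, 0 < CF /\
    forall V B, varifold G V -> gen_curvature G V B -> (mass V <= CF%:E * energy F V B)%E) ->
  exists Phi : R -> R,
      [/\ (forall s t, 0 <= s -> s <= t -> Phi s <= Phi t), Phi 0 = 0,
          (forall t, 0 <= t -> 0 <= Phi t) &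
          exists F, condF G F /\
            forall V B, varifold G V -> gen_curvature G V B ->
              (energy F V B < +oo)%E ->
              (mass V <= (Phi (fine (energy F V B)))%:E)%E].
  move=> /(_ _ (@normr_sqr_condF R S G))[C [C0 HC]].
  exists (fun t => C * t); split.
  - by move=> s t s0 st; rewrite ler_wpM2l// ltW.
  - by rewrite mulr0.
  - by move=> t t0; rewrite mulr_ge0// ltW.
  - exists (fun _ q => `|q| ^+ 2); split; first exact: normr_sqr_condF.
    move=> V B vV cV Efin; rewrite EFinM fineK; first exact: HC.
    by rewrite ge0_fin_numE// integral_ge0// => z _; rewrite lee_fin sqr_ge0.
have ii_i : (exists Phi : R -> R,
      [/\ (forall s t, 0 <= s -> s <= t -> Phi s <= Phi t), Phi 0 = 0,
          (forall t, 0 <= t -> 0 <= Phi t) &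
          exists F, condF G F /\
            forall V B, varifold G V -> gen_curvature G V B ->
              (energy F V B < +oo)%E ->
              (mass V <= (Phi (fine (energy F V B)))%:E)%E]) -> cond_i.
  move=> [Phi [_ Phi0 _ [F [HF H]]]] V B vV cV flat.
  have [_ F0 _ _] := HF.
  have E0 : energy F V B = 0%E.
    apply: integral_ae_zero_ge0 => //.
      by move=> z Gz; rewrite lee_fin; case: (F0 z (sff Q B z) Gz).
    case: flat => A [mA A0 fA]; exists A; split => // z /= nz; apply: fA => /= h; apply: nz => Gz.
    by rewrite (F0 z (sff Q B z) Gz).2.2// h.
  apply/eqP; rewrite eq_le measure_ge0 andbT.
  by have := H V B vV cV; rewrite E0 /= Phi0; apply; rewrite ltry.
split; split => [ci|h].
- exact/iii_ii/i_iii.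
- exact: ii_i.
- exact: i_iii.
- exact/ii_i/iii_ii.
Qed.
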